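(* Let $K$ be a torus knot with knot group isomorphic to $G_{pt}=\langle a,b;\ a^p=b^t\rangle$, where $p,t$ are relatively prime integers greater than one. Then the genus of $K$ equals the number of four-dimensional irreducible components of the affine algebraic variety $R(G_{pt})$.
   Context: For a finitely generated group $G$, $R(G)$ denotes the set $\mathrm{Hom}(G,SL_2(\mathbb{C}))$ with its structure of affine algebraic variety over $\mathbb{C}$: choosing generators $x_1,\dots,x_n$ of $G$, a homomorphism $\rho$ is identified with the tuple $(\rho(x_1),\dots,\rho(x_n))\in (SL_2(\mathbb{C}))^n$, and $R(G)$ is the Zariski-closed set of tuples so obtained (up to isomorphism it does not depend on the choice of generators). Concretely, $R(G_{pt})=\{(m_1,m_2)\in SL_2(\mathbb{C})\times SL_2(\mathbb{C}) : m_1^p=m_2^t\}$. The term ''algebraic variety'' does not presuppose irreducibility; irreducible components are the maximal irreducible closed subsets. The knot group of $K$ is the fundamental group of the complement of $K$ in $S^3$; a torus knot has knot group isomorphic to some $G_{pt}$ with $p,t$ relatively prime. The genus of a torus knot can also be defined as half the rank of the commutator subgroup of its knot group. *)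

(* Defs.v *)
From HB Require Import structures.
From mathcomp Require Import all_boot all_order all_algebra.
From mathcomp Require Import generic_quotient complex.
From mathcomp Require Import all_classical all_reals all_analysis.
From mathcomp Require mpoly.
From mathcomp Require Import lra.
Set Implicit Arguments.
Unset Strict Implicit.
Unset Printing Implicit Defensive.
Import Order.TTheory GRing.Theory Num.Theory.
Import numFieldNormedType.Exports.
Local Open Scope classical_set_scope.
Local Open Scope ring_scope.
Local Open Scope quotient_scope.

Section Groups.
Local Open Scope group_scope.

Definition group_isomorphic (G H : groupType) : Prop :=
  exists f : G -> H, {morph f : x y / x * y} /\ bijective f.

Definition is_subgroup (G : groupType) (H : set G) : Prop :=
  [/\ H 1, forall x y, H x -> H y -> H (x * y) & forall x, H x -> H x^-1].

Definition subgroup_generated (G : groupType) (A : set G) : set G :=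
  smallest (@is_subgroup G) A.

Definition commutator_subgroup (G : groupType) : set G :=
  subgroup_generated [set z : G | exists x y : G, z = [~ x, y]].

Definition group_rank (G : groupType) (H : set G) (n : nat) : Prop :=
  (exists s : seq G, size s = n /\ subgroup_generated [set` s] = H) /\
  (forall s : seq G, subgroup_generated [set` s] = H -> (n <= size s)%N).

End Groups.

Section Presentation.
Variable n : nat.

(* The letter [(i, false)] is the generator [x_i] and [(i, true)] its inverse. *)
Definition word := seq ('I_n * bool).

Definition inv_letter (l : 'I_n * bool) := (l.1, ~~ l.2).
Definition inv_word (w : word) : word := rev (map inv_letter w).

(* A pair [(l, r)] stands for the relation [l = r]. *)
Variable rels : set (word * word).

Inductive word_eq : word -> word -> Prop :=
| word_eq_refl w : word_eq w w
| word_eq_sym v w : word_eq v w -> word_eq w v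
| word_eq_trans u v w : word_eq u v -> word_eq v w -> word_eq u w
| word_eq_cancel u l v : word_eq (u ++ l :: inv_letter l :: v) (u ++ v)
| word_eq_rel u l r v : rels (l, r) -> word_eq (u ++ l ++ v) (u ++ r ++ v).

Definition word_eqb : rel word := fun v w => `[< word_eq v w >].

Lemma word_eqb_refl : reflexive word_eqb.
Proof. by move=> w; apply/asboolP; exact: word_eq_refl. Qed.

Lemma word_eqb_sym : symmetric word_eqb.
Proof. by move=> v w; apply/asboolP/asboolP; exact: word_eq_sym. Qed.

Lemma word_eqb_trans : transitive word_eqb.
Proof.
by move=> v u w /asboolP uv /asboolP vw; apply/asboolP; apply: word_eq_trans vw.
Qed.

Canonical word_equiv :=
  EquivRel word_eqb word_eqb_refl word_eqb_sym word_eqb_trans.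

Definition presented_group := {eq_quot word_equiv}.

HB.instance Definition _ := Choice.on presented_group.

Definition presented_pi (w : word) : presented_group := \pi w.

Lemma presented_piP v w : presented_pi v = presented_pi w <-> word_eq v w.
Proof.
rewrite /presented_pi; split => [/eqmodP/asboolP //|vw].
by apply/eqmodP/asboolP.
Qed.

Lemma presented_ind (P : presented_group -> Prop) :
  (forall w, P (presented_pi w)) -> forall x, P x.
Proof. by move=> Pw x; rewrite -[x]reprK; exact: Pw. Qed.

Definition presented_one : presented_group := presented_pi [::].
Definition presented_mul (x y : presented_group) : presented_group :=
  presented_pi (repr x ++ repr y).
Definition presented_inv (x : presented_group) : presented_group :=
  presented_pi (inv_word (repr x)).

Lemma word_eq_repr w : word_eq (repr (presented_pi w)) w.
Proof. by apply/presented_piP; rewrite /presented_pi reprK. Qed.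

Lemma word_eq_ctx u v w z : word_eq v w -> word_eq (u ++ v ++ z) (u ++ w ++ z).
Proof.
elim=> {v w} [w|v w _|a v w _ IH1 _|a l v|a l r v rlr].
- exact: word_eq_refl.
- exact: word_eq_sym.
- by move: IH1; exact: word_eq_trans.
- by rewrite -!catA !catA -catA /= -[in X in word_eq _ X]catA;
    exact: word_eq_cancel.
- by rewrite -!catA catA [in X in word_eq _ X]catA; exact: word_eq_rel.
Qed.

Lemma word_eq_cat v v' w w' :
  word_eq v v' -> word_eq w w' -> word_eq (v ++ w) (v' ++ w').
Proof.
move=> vv ww; apply: (@word_eq_trans _ (v' ++ w)).
  exact: (word_eq_ctx [::] w vv).
by have := word_eq_ctx v' [::] ww; rewrite !cats0.
Qed.

Lemma inv_letterK : involutive inv_letter.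
Proof. by case=> i b; rewrite /inv_letter /= negbK. Qed.

Lemma inv_wordK : involutive inv_word.
Proof.
by move=> w; rewrite /inv_word map_rev revK -map_comp map_id_in // => l _;
  exact: inv_letterK.
Qed.

Lemma word_eq_mulV w : word_eq (w ++ inv_word w) [::].
Proof.
elim: w => [|l w IH]; first exact: word_eq_refl.
rewrite /inv_word /= rev_cons -cats1 -/(inv_word w).
have := word_eq_ctx [:: l] [:: inv_letter l] IH; rewrite /= -!catA /=.
move/word_eq_trans; apply.
exact: (word_eq_cancel [::] l [::]).
Qed.

Lemma word_eq_mulVw w : word_eq (inv_word w ++ w) [::].
Proof. by rewrite -{2}[w]inv_wordK; exact: word_eq_mulV. Qed.

Lemma presented_mul_pi v w :
  presented_mul (presented_pi v) (presented_pi w) = presented_pi (v ++ w).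
Proof. by apply/presented_piP; apply: word_eq_cat; exact: word_eq_repr. Qed.

Lemma presented_mulA : associative presented_mul.
Proof.
elim/presented_ind=> u; elim/presented_ind=> v; elim/presented_ind=> w.
by rewrite !presented_mul_pi catA.
Qed.

Lemma presented_mul1g : left_id presented_one presented_mul.
Proof. by elim/presented_ind=> w; rewrite presented_mul_pi. Qed.

Lemma presented_mulg1 : right_id presented_one presented_mul.
Proof. by elim/presented_ind=> w; rewrite presented_mul_pi cats0. Qed.

Lemma presented_mulVg :
  left_inverse presented_one presented_inv presented_mul.
Proof.
move=> x; rewrite -{2}[x]reprK presented_mul_pi.
by apply/presented_piP; exact: word_eq_mulVw.
Qed.

Lemma presented_mulgV :
  right_inverse presented_one presented_inv presented_mul.
Proof.
move=> x; rewrite -{1}[x]reprK presented_mul_pi.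
by apply/presented_piP; exact: word_eq_mulV.
Qed.

HB.instance Definition _ := isGroup.Build presented_group
  presented_mulA presented_mul1g presented_mulg1
  presented_mulVg presented_mulgV.

Definition presented_gen (i : 'I_n) : presented_group :=
  presented_pi [:: (i, false)].

End Presentation.

(** [Gpt p t] is < a, b ; a^p = b^t >, with [a], [b] the generators of index
    0 and 1. *)
Definition Gpt_rels (p t : nat) : set (word 2 * word 2) :=
  [set (nseq p (0 : 'I_2, false), nseq t (1 : 'I_2, false))].

Definition Gpt (p t : nat) : groupType := presented_group (Gpt_rels p t).

Definition Gpt_gen (p t : nat) : 'I_2 -> Gpt p t :=
  @presented_gen 2 (Gpt_rels p t).

Arguments Gpt_gen p t _ : clear implicits.

Lemma within_comp (S T U : topologicalType) (B : set S) (A : set T)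
    (f : T -> U) (phi : S -> T) :
  {within A, continuous f} -> {within B, continuous phi} ->
  (forall x, B x -> A (phi x)) -> {within B, continuous (f \o phi)}.
Proof.
move=> /subspace_continuousP cf /subspace_continuousP cphi BA.
apply/subspace_continuousP => x Bx.
apply: (@cvg_comp _ _ _ phi f _ (within A (nbhs (phi x)))); last first.
  by apply: cf; exact: BA.
move=> P /(cphi x Bx); rewrite /nbhs /= /within /= => H.
by apply: filterS H => y H By; apply: H => //; exact: BA.
Qed.

Lemma within_ext (S T : topologicalType) (A : set S) (f g : S -> T) :
  (forall x, A x -> f x = g x) ->
  {within A, continuous f} -> {within A, continuous g}.
Proof.
by move=> fg; apply: subspace_eq_continuous => x xA; apply: fg; rewrite inE in xA.
Qed.

Lemma pair_continuous (S T U : topologicalType) (f : S -> T) (g : S -> U) :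
  continuous f -> continuous g -> continuous (fun x => (f x, g x)).
Proof. by move=> cf cg x; apply: cvg_pair; [exact: cf|exact: cg]. Qed.

Section Paste.
Variables (R : realType) (S T : topologicalType).

Lemma paste_continuous (D : set S) (a : S -> R) (c : R) (f g : S -> T) :
  closed D -> continuous a ->
  {within D `&` [set x | a x <= c], continuous f} ->
  {within D `&` [set x | c <= a x], continuous g} ->
  (forall x, D x -> a x = c -> f x = g x) ->
  {within D, continuous (fun x => if a x <= c then f x else g x)}.
Proof.
move=> cD ca cf cg fg.
have -> : D = (D `&` [set x | a x <= c]) `|` (D `&` [set x | c <= a x]).
  rewrite -setIUr; apply/seteqP; split => [x Dx|x []//]; split => //=.
  by case: (leP (a x) c) => h; [left|right; exact: ltW].
apply: withinU_continuous.
- apply: closedI => //.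
  rewrite (_ : mkset _ = a @^-1` [set x | x <= c]) //.
  by apply: preimage_closed => //; exact: closed_le.
- apply: closedI => //.
  rewrite (_ : mkset _ = a @^-1` [set x | c <= x]) //.
  by apply: preimage_closed => //; exact: closed_ge.
- by apply: within_ext cf => x [Dx /= ->].
- apply: within_ext cg => x [Dx /= cx]; case: (leP (a x) c) => // xc.
  by rewrite -fg //; apply/eqP; rewrite eq_le xc.
Qed.

End Paste.

Section FundamentalGroup.
Variables (R : realType) (X : topologicalType) (x0 : X).

Local Notation I := (`[0, 1]%classic : set R).

Definition is_loop (f : R -> X) : Prop :=
  [/\ {within I, continuous f}, f 0 = x0 & f 1 = x0].

(* Values outside [0, 1] are irrelevant: they are identified by [homotopic]. *)
Record loop := Loop { loop_fun :> R -> X; loopP : is_loop loop_fun }.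

HB.instance Definition _ := gen_eqMixin loop.
HB.instance Definition _ := gen_choiceMixin loop.

Definition homotopic (f g : R -> X) : Prop :=
  exists H : R * R -> X,
    [/\ {within I `*` I, continuous H},
        forall s, I s -> H (s, 0) = f s,
        forall s, I s -> H (s, 1) = g s &
        forall t, I t -> H (0, t) = x0 /\ H (1, t) = x0].

Let I0 : I 0. Proof. by rewrite /= in_itv /= lexx ler01. Qed.
Let I1 : I 1. Proof. by rewrite /= in_itv /= lexx ler01. Qed.
Let IP (s : R) : I s <-> 0 <= s <= 1. Proof. by rewrite /= in_itv. Qed.
Let closedI1 : closed I. Proof. exact: interval_closed. Qed.
Let closedII : closed (I `*` I). Proof.
have -> : I `*` I = fst @^-1` I `&` snd @^-1` I :> set (R * R) by [].
by apply: closedI; apply: preimage_closed => // u _; [exact: cvg_fst|exact: cvg_snd].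
Qed.

Lemma homotopic_reparam (f : R -> X) (phi psi : R -> R) :
  is_loop f -> continuous phi -> continuous psi ->
  (forall s, I s -> I (phi s)) -> (forall s, I s -> I (psi s)) ->
  phi 0 = psi 0 -> phi 1 = psi 1 -> f (phi 0) = x0 -> f (phi 1) = x0 ->
  homotopic (f \o phi) (f \o psi).
Proof.
move=> [cf f0 f1] cphi cpsi Iphi Ipsi e0 e1 fp0 fp1.
pose h (u : R * R) := (1 - u.2) * phi u.1 + u.2 * psi u.1.
exists (f \o h); split.
- apply: (within_comp cf).
    apply: continuous_subspaceT => u.
    have c1 : {for u, continuous (fun v : R * R => phi v.1)}.
      by apply: (@continuous_comp _ _ _ fst phi); [exact: cvg_fst|exact: cphi].
    have c2 : {for u, continuous (fun v : R * R => psi v.1)}.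
      by apply: (@continuous_comp _ _ _ fst psi); [exact: cvg_fst|exact: cpsi].
    apply: cvgD; apply: cvgM; [|exact: c1|exact: cvg_snd|exact: c2].
    by apply: cvgB; [exact: cvg_cst|exact: cvg_snd].
  move=> [s t] [/= Is It]; rewrite /h /=.
  have /IP/andP[a0 a1] := Iphi s Is; have /IP/andP[b0 b1] := Ipsi s Is.
  move/IP/andP: It => [t0 t1]; apply/IP; nra.
- by move=> s _; rewrite /= /h /= subr0 mul1r mul0r addr0.
- by move=> s _; rewrite /= /h /= subrr mul1r mul0r add0r.
- move=> t _; rewrite /= /h /= -e0 -e1 -!mulrDl subrK !mul1r.
  by split.
Qed.

Lemma homotopic_refl (f : loop) : homotopic f f.
Proof.
case: f => f fl /=; case: (fl) => _ f0 f1.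
by apply: (@homotopic_reparam f idfun idfun) => //; move=> ?; exact: cvg_id.
Qed.

Lemma homotopic_sym (f g : R -> X) : homotopic f g -> homotopic g f.
Proof.
move=> [H [cH H0 H1 Hx]]; exists (H \o (fun u => (u.1, 1 - u.2))); split.
- apply: (within_comp cH).
    apply: continuous_subspaceT; apply: pair_continuous => u; first exact: cvg_fst.
    by apply: cvgB; [exact: cvg_cst|exact: cvg_snd].
  move=> [s t] [/= Is /IP It]; split => //=; apply/IP; lra.
- by move=> s Is /=; rewrite subr0 H1.
- by move=> s Is /=; rewrite subrr H0.
- by move=> t /IP It /=; apply: Hx; apply/IP; lra.
Qed.

Lemma homotopic_trans (g f h : R -> X) :
  homotopic f g -> homotopic g h -> homotopic f h.
Proof.
move=> [H [cH H0 H1 Hx]] [K [cK K0 K1 Kx]].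
pose lo (u : R * R) := (u.1, 2 * u.2); pose hi (u : R * R) := (u.1, 2 * u.2 - 1).
exists (fun u => if u.2 <= 2^-1 then (H \o lo) u else (K \o hi) u); split.
- apply: paste_continuous => //.
  + by move=> u; exact: cvg_snd.
  + apply: (within_comp cH).
      apply: continuous_subspaceT; apply: pair_continuous => u; first exact: cvg_fst.
      by apply: cvgM; [exact: cvg_cst|exact: cvg_snd].
    move=> [s t] [[/= Is /IP It] /= t2]; split => //=; apply/IP; lra.
  + apply: (within_comp cK).
      apply: continuous_subspaceT; apply: pair_continuous => u; first exact: cvg_fst.
      apply: cvgB; last exact: cvg_cst.
      by apply: cvgM; [exact: cvg_cst|exact: cvg_snd].
    move=> [s t] [[/= Is /IP It] /= t2]; split => //=; apply/IP; lra.
  + move=> [s t] [/= Is _] ->; rewrite /lo /hi /= mulfV ?pnatr_eq0 // subrr.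
    by rewrite H1 // K0.
- move=> s Is /=; rewrite ifT ?invr_ge0 ?ler0n // /lo /= mulr0; exact: H0.
- move=> s Is /=; rewrite ifF; last by apply/negbTE; rewrite -ltNge; lra.
  by rewrite /hi /= mulr1 (_ : 2 - 1 = 1 :> R); [exact: K1|lra].
- move=> t /IP It /=; have [t2|t2] := leP _ 2^-1.
    by apply: (Hx (2 * t)); apply/IP; lra.
  by apply: (Kx (2 * t - 1)); apply/IP; lra.
Qed.

Definition homotopicb : rel loop := fun f g => `[< homotopic f g >].

Lemma homotopicb_refl : reflexive homotopicb.
Proof. by move=> f; apply/asboolP; exact: homotopic_refl. Qed.

Lemma homotopicb_sym : symmetric homotopicb.
Proof. by move=> f g; apply/asboolP/asboolP; exact: homotopic_sym. Qed.

Lemma homotopicb_trans : transitive homotopicb.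
Proof.
by move=> g f h /asboolP fg /asboolP gh; apply/asboolP; apply: homotopic_trans gh.
Qed.

Canonical homotopy_equiv :=
  EquivRel homotopicb homotopicb_refl homotopicb_sym homotopicb_trans.

Definition path_concat (f g : R -> X) (s : R) : X :=
  if s <= 2^-1 then f (2 * s) else g (2 * s - 1).

Definition path_reverse (f : R -> X) (s : R) : X := f (1 - s).

Let half01 : (0 <= 2^-1 :> R) * ((1 <= 2^-1 :> R) = false) * (2 - 1 = 1 :> R).
Proof.
by split; [split|]; [lra|apply/negbTE; rewrite -ltNge; lra|lra].
Qed.

Let affine_cont (a b : R) : continuous (fun s : R => a * s + b).
Proof.
move=> s; apply: cvgD; last exact: cvg_cst.
by apply: cvgM; [exact: cvg_cst|exact: cvg_id].
Qed.

Lemma path_concat_loop f g : is_loop f -> is_loop g -> is_loop (path_concat f g).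
Proof.
move=> [cf f0 f1] [cg g0 g1]; split; last 2 first.
- by rewrite /path_concat half01 mulr0.
- by rewrite /path_concat half01 mulr1 half01.
apply: (@paste_continuous R R X I idfun 2^-1
  (fun s => f (2 * s)) (fun s => g (2 * s - 1))) => //.
- by move=> s; exact: cvg_id.
- apply: (@within_comp R R X _ I f (fun s => 2 * s) cf).
    apply: continuous_subspaceT => s.
    by apply: cvgM; [exact: cvg_cst|exact: cvg_id].
  by move=> s [/IP Is /= s2]; apply/IP; lra.
- apply: (@within_comp R R X _ I g (fun s => 2 * s - 1) cg).
    by apply: continuous_subspaceT => s; exact: affine_cont.
  by move=> s [/IP Is /= s2]; apply/IP; lra.
- by move=> s _ /= ->; rewrite mulfV ?pnatr_eq0 // subrr f1 g0.
Qed.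

Lemma path_reverse_loop f : is_loop f -> is_loop (path_reverse f).
Proof.
move=> [cf f0 f1]; split; last 2 first.
- by rewrite /path_reverse subr0.
- by rewrite /path_reverse subrr.
apply: (@within_comp R R X _ I f (fun s => 1 - s) cf).
  apply: continuous_subspaceT => s.
  by apply: cvgB; [exact: cvg_cst|exact: cvg_id].
by move=> s /IP Is; apply/IP; lra.
Qed.

Lemma const_loop : is_loop (fun=> x0).
Proof. by split=> //; apply: continuous_subspaceT => s; exact: cvg_cst. Qed.

Definition loop_one : loop := Loop const_loop.
Definition loop_mul (f g : loop) : loop :=
  Loop (path_concat_loop (loopP f) (loopP g)).
Definition loop_inv (f : loop) : loop := Loop (path_reverse_loop (loopP f)).

Lemma homotopic_concat (f f' g g' : R -> X) :
  homotopic f f' -> homotopic g g' ->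
  homotopic (path_concat f g) (path_concat f' g').
Proof.
move=> [H [cH H0 H1 Hx]] [K [cK K0 K1 Kx]].
pose lo (u : R * R) := (2 * u.1, u.2); pose hi (u : R * R) := (2 * u.1 - 1, u.2).
exists (fun u => if u.1 <= 2^-1 then (H \o lo) u else (K \o hi) u); split.
- apply: paste_continuous => //.
  + by move=> u; exact: cvg_fst.
  + apply: (within_comp cH).
      apply: continuous_subspaceT; apply: pair_continuous => u; last exact: cvg_snd.
      by apply: cvgM; [exact: cvg_cst|exact: cvg_fst].
    move=> [s t] [[/= /IP Is It] /= t2]; split => //=; apply/IP; lra.
  + apply: (within_comp cK).
      apply: continuous_subspaceT; apply: pair_continuous => u; last exact: cvg_snd.
      apply: cvgB; last exact: cvg_cst.
      by apply: cvgM; [exact: cvg_cst|exact: cvg_fst].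
    move=> [s t] [[/= /IP Is It] /= t2]; split => //=; apply/IP; lra.
  + move=> [s t] [/= _ It] ->; rewrite /lo /hi /= mulfV ?pnatr_eq0 // subrr.
    by rewrite (Hx t It).2 (Kx t It).1.
- move=> s /IP Is /=; rewrite /path_concat; have [t2|t2] := leP _ 2^-1.
    by apply: (H0 (2 * s)); apply/IP; lra.
  by apply: (K0 (2 * s - 1)); apply/IP; lra.
- move=> s /IP Is /=; rewrite /path_concat; have [t2|t2] := leP _ 2^-1.
    by apply: (H1 (2 * s)); apply/IP; lra.
  by apply: (K1 (2 * s - 1)); apply/IP; lra.
- move=> t It /=; rewrite !half01 /lo /hi /= mulr0 mulr1 half01.
  by rewrite (Hx t It).1 (Kx t It).2.
Qed.

Let homotopic_ext (f f' g g' : R -> X) :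
  (forall s, I s -> f s = f' s) -> (forall s, I s -> g s = g' s) ->
  homotopic f g -> homotopic f' g'.
Proof.
move=> ff gg [H [cH H0 H1 Hx]]; exists H; split => // s Is.
  by rewrite H0 ?ff.
by rewrite H1 ?gg.
Qed.

Let min_cont (f g : R -> R) : continuous f -> continuous g ->
  continuous (fun s => Num.min (f s) (g s)).
Proof. by move=> cf cg s; apply: continuous_min; [exact: cf|exact: cg]. Qed.

Let max_cont (f g : R -> R) : continuous f -> continuous g ->
  continuous (fun s => Num.max (f s) (g s)).
Proof. by move=> cf cg s; apply: continuous_max; [exact: cf|exact: cg]. Qed.

Let id_cont : continuous (idfun : R -> R).
Proof. by move=> s; exact: cvg_id. Qed.

Lemma homotopic_concatA (f g h : loop) :
  homotopic (path_concat f (path_concat g h)) (path_concat (path_concat f g) h).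
Proof.
have fgh := path_concat_loop (loopP f) (path_concat_loop (loopP g) (loopP h)).
have [_ e0 e1] := fgh.
pose phi (s : R) :=
  Num.min (Num.min (2 * s + 0) (1 * s + 4^-1)) (2^-1 * s + 2^-1).
have phi0 : phi 0 = 0.
  by rewrite /phi /Num.min; do ?case: ifPn; rewrite -?leNgt => ? ?; lra.
have phi1 : phi 1 = 1.
  by rewrite /phi /Num.min; do ?case: ifPn; rewrite -?leNgt => ? ?; lra.
apply: (@homotopic_ext (path_concat f (path_concat g h) \o idfun) _
  (path_concat f (path_concat g h) \o phi)) => //; last first.
  apply: homotopic_reparam => //; rewrite ?phi0 ?phi1 //.
    by do 2?apply: min_cont; exact: affine_cont.
  move=> s /IP Is; apply/IP.
  by rewrite /phi /Num.min; do ?case: ifPn; rewrite -?leNgt => ? ?; lra.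
move=> s /IP Is.
have half2 : 2 * 2^-1 = 1 :> R by lra.
rewrite /= /path_concat.
have -> : phi s = if s <= 4^-1 then 2 * s else
    if s <= 2^-1 then s + 4^-1 else 2^-1 * s + 2^-1.
  by rewrite /phi /Num.min; do ?case: ifPn; rewrite -?leNgt -?ltNge => *; lra.
have [s4|s4] := leP s 4^-1.
  by rewrite !ifT //; lra.
have [s2|s2] := leP s 2^-1.
  rewrite ifF; last by apply/negbTE; rewrite -ltNge; lra.
  rewrite ifT; last by lra.
  rewrite ifF; last by apply/negbTE; rewrite -ltNge; lra.
  by congr (g _); lra.
rewrite ifF; last by apply/negbTE; rewrite -ltNge; lra.
rewrite ifF; last by apply/negbTE; rewrite -ltNge; lra.
by congr (h _); lra.
Qed.

Lemma homotopic_concat1l (f : loop) : homotopic (path_concat (fun=> x0) f) f.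
Proof.
have [_ e0 e1] := loopP f.
pose phi (s : R) := Num.max (0 * s + 0) (2 * s - 1).
have phi0 : phi 0 = 0.
  by rewrite /phi /Num.max; do ?case: ifPn; rewrite -?leNgt => ?; lra.
have phi1 : phi 1 = 1.
  by rewrite /phi /Num.max; do ?case: ifPn; rewrite -?leNgt => ?; lra.
apply: (@homotopic_ext (f \o phi) _ (f \o idfun)) => //; last first.
  apply: homotopic_reparam => //; rewrite ?phi0 ?phi1 //; first exact: loopP.
    by apply: max_cont; exact: affine_cont.
  move=> s /IP Is; apply/IP.
  by rewrite /phi /Num.max; do ?case: ifPn; rewrite -?leNgt => ?; lra.
move=> s /IP Is; rewrite /= /path_concat; case: ifPn; rewrite -?ltNge => s2.
  by rewrite -e0; congr (loop_fun f _); rewrite /phi max_l; lra.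
by congr (loop_fun f _); rewrite /phi max_r; lra.
Qed.

Lemma homotopic_concat1r (f : loop) : homotopic (path_concat f (fun=> x0)) f.
Proof.
have [_ e0 e1] := loopP f.
pose phi (s : R) := Num.min (2 * s + 0) (0 * s + 1).
have phi0 : phi 0 = 0.
  by rewrite /phi /Num.min; do ?case: ifPn; rewrite -?leNgt => ?; lra.
have phi1 : phi 1 = 1.
  by rewrite /phi /Num.min; do ?case: ifPn; rewrite -?leNgt => ?; lra.
apply: (@homotopic_ext (f \o phi) _ (f \o idfun)) => //; last first.
  apply: homotopic_reparam => //; rewrite ?phi0 ?phi1 //; first exact: loopP.
    by apply: min_cont; exact: affine_cont.
  move=> s /IP Is; apply/IP.
  by rewrite /phi /Num.min; do ?case: ifPn; rewrite -?leNgt => ?; lra.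
move=> s /IP Is; rewrite /= /path_concat; case: ifPn; rewrite -?ltNge => s2.
  by congr (loop_fun f _); rewrite /phi min_l; lra.
by rewrite -e1; congr (loop_fun f _); rewrite /phi min_r; lra.
Qed.

Lemma homotopic_concatV (f : loop) :
  homotopic (path_concat f (path_reverse f)) (fun=> x0).
Proof.
have [_ e0 e1] := loopP f.
pose phi (s : R) := Num.min (2 * s + 0) (- 2 * s + 2).
have phi0 : phi 0 = 0.
  by rewrite /phi /Num.min; do ?case: ifPn; rewrite -?leNgt => ?; lra.
have phi1 : phi 1 = 0.
  by rewrite /phi /Num.min; do ?case: ifPn; rewrite -?leNgt => ?; lra.
apply: (@homotopic_ext (f \o phi) _ (f \o (fun=> 0))) => //; last first.
  apply: homotopic_reparam => //; rewrite ?phi0 ?phi1 //; first exact: loopP.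
  - by apply: min_cont; exact: affine_cont.
  - by move=> s; exact: cvg_cst.
  move=> s /IP Is; apply/IP.
  by rewrite /phi /Num.min; do ?case: ifPn; rewrite -?leNgt => ?; lra.
move=> s /IP Is; rewrite /= /path_concat; case: ifPn; rewrite -?ltNge => s2.
  by congr (loop_fun f _); rewrite /phi min_l; lra.
by rewrite /path_reverse; congr (loop_fun f _); rewrite /phi min_r; lra.
Qed.

Lemma homotopic_concatVl (f : loop) :
  homotopic (path_concat (path_reverse f) f) (fun=> x0).
Proof.
apply: homotopic_ext (homotopic_concatV (loop_inv f)) => // s Is.
rewrite /path_concat /= /path_reverse; case: ifP => // _.
by rewrite opprB addrCA subrr addr0.
Qed.

Definition pi1 := {eq_quot homotopy_equiv}.

HB.instance Definition _ := Choice.on pi1.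

Definition pi1_class (f : loop) : pi1 := \pi f.

Lemma pi1_classP f g : pi1_class f = pi1_class g <-> homotopic f g.
Proof.
rewrite /pi1_class; split => [/eqmodP/asboolP //|fg].
by apply/eqmodP/asboolP.
Qed.

Lemma pi1_ind (P : pi1 -> Prop) :
  (forall f, P (pi1_class f)) -> forall x, P x.
Proof. by move=> Pf x; rewrite -[x]reprK; exact: Pf. Qed.

Definition pi1_one : pi1 := pi1_class loop_one.
Definition pi1_mul (x y : pi1) : pi1 := pi1_class (loop_mul (repr x) (repr y)).
Definition pi1_inv (x : pi1) : pi1 := pi1_class (loop_inv (repr x)).

Lemma pi1_mul_class f g :
  pi1_mul (pi1_class f) (pi1_class g) = pi1_class (loop_mul f g).
Proof.
by apply/pi1_classP; apply: homotopic_concat; apply/pi1_classP;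
  rewrite /pi1_class reprK.
Qed.

Lemma pi1_mulA : associative pi1_mul.
Proof.
elim/pi1_ind=> f; elim/pi1_ind=> g; elim/pi1_ind=> h.
by rewrite !pi1_mul_class; apply/pi1_classP; exact: homotopic_concatA.
Qed.

Lemma pi1_mul1g : left_id pi1_one pi1_mul.
Proof.
elim/pi1_ind=> f; rewrite pi1_mul_class.
by apply/pi1_classP; exact: homotopic_concat1l.
Qed.

Lemma pi1_mulg1 : right_id pi1_one pi1_mul.
Proof.
elim/pi1_ind=> f; rewrite pi1_mul_class.
by apply/pi1_classP; exact: homotopic_concat1r.
Qed.

Lemma pi1_mulVg : left_inverse pi1_one pi1_inv pi1_mul.
Proof.
move=> x; rewrite -{2}[x]reprK pi1_mul_class.
by apply/pi1_classP; exact: homotopic_concatVl.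
Qed.

Lemma pi1_mulgV : right_inverse pi1_one pi1_inv pi1_mul.
Proof.
move=> x; rewrite -{1}[x]reprK pi1_mul_class.
by apply/pi1_classP; exact: homotopic_concatV.
Qed.

HB.instance Definition _ := isGroup.Build pi1
  pi1_mulA pi1_mul1g pi1_mulg1 pi1_mulVg pi1_mulgV.

End FundamentalGroup.

(* The type [sphere3 R] carries the topology induced from [R^4]. *)
Definition sphere3 (R : realType) : topologicalType :=
  set_type [set v : 'rV[R]_4 | \sum_i v ord0 i ^+ 2 = 1].

Definition homeomorphism (X Y : topologicalType) (h : X -> Y) : Prop :=
  continuous h /\ exists k : Y -> X, [/\ continuous k, cancel h k & cancel k h].

(* The curve (exp(i r theta), exp(i s theta)) / sqrt 2 in the unit sphere of
   C^2 = R^4. *)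
Definition standard_torus_curve (R : realType) (r s : nat) (theta : R) :
    'rV[R]_4 :=
  (Num.sqrt 2)^-1 *: \row_(i < 4)
    nth 0 [:: cos (theta *+ r); sin (theta *+ r);
              cos (theta *+ s); sin (theta *+ s)] i.

Definition standard_torus_knot (R : realType) (r s : nat) : set (sphere3 R) :=
  [set q | exists theta : R, val q = standard_torus_curve r s theta].

Arguments standard_torus_knot R r s : clear implicits.

(* Orientation-reversing homeomorphisms are allowed, so mirror images (negative
   [r] or [s]) are included. *)
Definition torus_knot (R : realType) (K : set (sphere3 R)) : Prop :=
  exists (r s : nat) (h : sphere3 R -> sphere3 R),
    [/\ coprime r s, homeomorphism h & K = h @` standard_torus_knot R r s].

Definition knot_complement (R : realType) (K : set (sphere3 R)) :
    topologicalType :=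
  set_type (~` K).

Definition knot_group (R : realType) (K : set (sphere3 R))
    (x : knot_complement K) : groupType :=
  pi1 R x.

(* The genus of a torus knot is half the rank of the commutator subgroup of its
   knot group. *)
Definition torus_knot_genus (R : realType) (K : set (sphere3 R))
    (x : knot_complement K) (g : nat) : Prop :=
  group_rank (@commutator_subgroup (knot_group x)) (2 * g)%N.

Section Zariski.
Variables (F : fieldType) (N : nat).
Implicit Types A Z V : set 'rV[F]_N.

Definition zariski_closed A : Prop :=
  exists S : set (mpoly.mpoly N F),
    A = [set v | forall f, S f -> mpoly.meval (v ord0) f = 0].

Definition zariski_irreducible A : Prop :=
  A !=set0 /\
  forall Z1 Z2, zariski_closed Z1 -> zariski_closed Z2 ->
    A `<=` Z1 `|` Z2 -> A `<=` Z1 \/ A `<=` Z2.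

Definition irreducible_closed_in V Z : Prop :=
  [/\ zariski_closed Z, zariski_irreducible Z & Z `<=` V].

Definition irreducible_component V Z : Prop :=
  irreducible_closed_in V Z /\
  forall Z', irreducible_closed_in V Z' -> Z `<=` Z' -> Z' = Z.

Definition irreducible_chain V (d : nat) : Prop :=
  exists Z : nat -> set 'rV[F]_N,
    (forall i, (i <= d)%N -> irreducible_closed_in V (Z i)) /\
    (forall i, (i < d)%N -> Z i `<` Z i.+1).

Definition krull_dim V (d : nat) : Prop :=
  irreducible_chain V d /\ forall m, irreducible_chain V m -> (m <= d)%N.

End Zariski.

Definition SL2_representation (R : realType) (G : groupType)
    (rho : G -> 'M[complex R]_2) : Prop :=
  [/\ rho 1%g = 1%:M,
      forall x y : G, rho (x * y)%g = rho x *m rho y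
    & forall x : G, \det (rho x) = 1].

(* The tuple of 2 x 2 matrices (rho(x_1), ..., rho(x_n)) as a point of affine
   space of dimension n * (2 * 2). *)
Definition representation_point (R : realType) (G : groupType) (n : nat)
    (x : 'I_n -> G) (rho : G -> 'M[complex R]_2) : 'rV[complex R]_(n * (2 * 2)) :=
  mxvec (\matrix_(i < n) mxvec (rho (x i))).

Definition representation_variety (R : realType) (G : groupType) (n : nat)
    (x : 'I_n -> G) : set 'rV[complex R]_(n * (2 * 2)) :=
  [set v | exists rho, SL2_representation rho /\ v = representation_point x rho].

Arguments representation_variety R {G n} x.

(* Main.v *)
From HB Require Import structures.
Require Import Defs.
From mathcomp Require Import all_boot all_order all_algebra.
From mathcomp Require Import complex.
From mathcomp Require Import all_classical all_reals all_analysis.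
From mathcomp Require mpoly cyclic separable cyclotomic.
From mathcomp Require Import zify ring.
Set Implicit Arguments.
Unset Strict Implicit.
Unset Printing Implicit Defensive.
Import Order.TTheory GRing.Theory Num.Theory.
Local Open Scope classical_set_scope.

(** Genus. In Gpt p t = < a, b ; a^p = b^t > the element a^p is central, so the
    commutators [a^i, b^j] with 0 < i < p and 0 < j < t generate a normal
    subgroup with abelian quotient, that is, the commutator subgroup
    ([Gpt_commutator_subgroup]). No fewer elements generate it: the group acts on
    p by t matrices by affine maps, the generator a shifting the rows about one
    fixed point and b shifting the columns about another, and its commutator
    subgroup acts by translations whose vectors span a space of dimension at
    least (p - 1)(t - 1) ([size_generators_commutator_subgroup]). So the rank of
    the commutator subgroup is (p - 1)(t - 1).

    Components. A representation is a pair (A, B) in SL2 with A^p = B^t. If A and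
    B do not commute, then A^p, which commutes with both, is scalar, equal to 1 or
    -1; hence A and B are diagonalizable, with eigenvalues w^k, w^-k and z^l, z^-l
    where w and z are primitive roots of unity of orders 2p and 2t, 0 < k < p,
    0 < l < t, and k = l modulo 2 ([pair_variety_cover]). For each such (k, l) the
    pairs with these eigenvalues form a product of two conjugacy classes, which is
    closed, irreducible and of dimension 4 ([krull_dim_class_pair]). The commuting
    pairs are the (c^t, c^p) with c in SL2 and have dimension at most 3
    ([commuting_pairs_dominated]). So the four-dimensional components are exactly
    the products of classes ([four_dimensional_components]), and there are
    (p - 1)(t - 1) / 2 of them, since p and t are not both even.

    Dimension. A strict inclusion of irreducible closed sets provides a polynomial
    function that vanishes on the smaller set only, and adjoining it keeps a family
    of functions algebraically independent ([alg_independent_cons]). So a chain of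
    length d yields d algebraically independent functions. On a set in which the
    image of a polynomial map from affine n-space is dense there are at most n of
    them, by counting monomials ([alg_independent_affine]). *)

(** * Subgroups, commutators and ranks *)

Local Open Scope group_scope.

Section Subgroups.
Implicit Types G H : groupType.

Lemma subgroup_generated_is_subgroup G (A : set G) :
  is_subgroup (subgroup_generated A).
Proof.
split.
- by move=> B [[B1 _ _] _].
- by move=> x y Ax Ay B CB; case: (CB) => [[_ BM _] _]; exact: BM (Ax _ CB) (Ay _ CB).
- by move=> x Ax B CB; case: (CB) => [[_ _ BV] _]; exact: BV (Ax _ CB).
Qed.

Lemma subgroup_generatedS G (A B : set G) :
  A `<=` subgroup_generated B -> subgroup_generated A `<=` subgroup_generated B.
Proof. by move=> AB; apply: smallest_sub => //; exact: subgroup_generated_is_subgroup. Qed.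

Lemma subgroup_generated_image G H (f : G -> H) (A : set G) :
  {morph f : x y / x * y} ->
  subgroup_generated (f @` A) = f @` subgroup_generated A.
Proof.
move=> fM.
have f1 : f 1 = 1 by apply: (mulgI (f 1)); rewrite -fM !mulg1.
have fV x : f x^-1 = (f x)^-1 by apply: (mulgI (f x)); rewrite -fM !mulgV.
have [A1 AM AV] := subgroup_generated_is_subgroup A.
have [B1 BM BV] := subgroup_generated_is_subgroup (f @` A).
apply/seteqP; split; last first.
  move=> _ [x Ax <-].
  suff : subgroup_generated A `<=` f @^-1` subgroup_generated (f @` A) by exact.
  apply: smallest_sub; last by move=> y Ay; apply: sub_gen_smallest; exists y.
  by split=> [|y z|y]; rewrite /= ?f1 ?fM ?fV //; [exact: BM|exact: BV].
apply: smallest_sub.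
- split; first by exists 1.
  + by move=> _ _ [x Ax <-] [y Ay <-]; exists (x * y) => //; exact: AM.
  + by move=> _ [x Ax <-]; exists x^-1 => //; exact: AV.
- by move=> _ [x Ax <-]; exists x => //; exact: sub_gen_smallest.
Qed.

Lemma commutator_subgroup_image G H (f : G -> H) :
  {morph f : x y / x * y} -> bijective f ->
  @commutator_subgroup H = f @` @commutator_subgroup G.
Proof.
move=> fM [k fK kK]; rewrite -subgroup_generated_image //; congr subgroup_generated.
have f1 : f 1 = 1 by apply: (mulgI (f 1)); rewrite -fM !mulg1.
have fV x : f x^-1 = (f x)^-1 by apply: (mulgI (f x)); rewrite -fM !mulgV.
have fR x y : f [~ x, y] = [~ f x, f y] by rewrite /commg /conjg !fM !fV.
apply/seteqP; split => [_ [x [y ->]]|_ [_ [x [y ->]] <-]].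
  by exists [~ k x, k y]; [exists (k x), (k y)|rewrite fR !kK].
by exists (f x), (f y); rewrite fR.
Qed.

Lemma image_seq (T U : choiceType) (f : T -> U) (s : seq T) :
  [set` map f s] = f @` [set` s].
Proof.
apply/seteqP; split => [_ /mapP[x xs ->]|_ [x xs <-]]; first by exists x.
exact: map_f.
Qed.

Lemma group_rank_commutator_iso G H n :
  group_isomorphic G H -> group_rank (@commutator_subgroup H) n ->
  group_rank (@commutator_subgroup G) n.
Proof.
move=> [f [fM fbij]]; have fbij' := fbij; case: fbij' => k fK kK.
have kM : {morph k : x y / x * y}.
  by move=> x y; apply: (can_inj fK); rewrite fM !kK.
have kbij : bijective k by exists f.
move=> [[s [szs sG]] smin]; split.
  exists (map k s); rewrite size_map; split => //.
  by rewrite image_seq subgroup_generated_image // sG -commutator_subgroup_image.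
move=> u uG; rewrite -(size_map f); apply: smin.
by rewrite image_seq subgroup_generated_image // uG -commutator_subgroup_image.
Qed.

Lemma commMgJ G (x y z : G) : [~ x * y, z] = [~ x, z] ^ y * [~ y, z].
Proof. by rewrite /commg /conjg !invgM -!mulgA ?mulKg ?mulVKg. Qed.

Lemma commgMJ G (x y z : G) : [~ x, y * z] = [~ x, z] * [~ x, y] ^ z.
Proof. by rewrite /commg /conjg !invgM -!mulgA ?mulKg ?mulVKg. Qed.

End Subgroups.

(** * Maps out of a presented group *)

Section Evaluation.
Variables (n : nat) (rels : set (word n * word n)).
Variables (M : Type) (op : M -> M -> M) (e : M) (h : 'I_n * bool -> M).
Hypotheses (opA : associative op) (op1m : left_id e op) (opm1 : right_id e op).

Definition word_eval (w : word n) : M := foldr (fun l m => op (h l) m) e w.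

Lemma word_eval_cat v w : word_eval (v ++ w) = op (word_eval v) (word_eval w).
Proof. by elim: v => [|l v IH]; rewrite /= ?op1m // IH opA. Qed.

Hypothesis hV : forall l, op (h l) (h (inv_letter l)) = e.
Hypothesis hrels : forall l r, rels (l, r) -> word_eval l = word_eval r.

Lemma word_eval_eq v w : word_eq rels v w -> word_eval v = word_eval w.
Proof.
elim=> {v w} [//|//|u v w _ -> _ ->//|u l v|u l r v /hrels lr].
  by rewrite !word_eval_cat /= [op (h l) _]opA hV op1m.
by rewrite !word_eval_cat lr.
Qed.

(** The map of the presented group induced by an assignment of letters that
    respects the relations. *)
Definition presented_eval (x : presented_group rels) : M := word_eval (repr x).

Lemma presented_eval_pi w : presented_eval (presented_pi rels w) = word_eval w.
Proof. by apply: word_eval_eq; exact: word_eq_repr. Qed.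

Lemma presented_eval1 : presented_eval 1 = e.
Proof. exact: presented_eval_pi. Qed.

Lemma presented_evalM x y :
  presented_eval (x * y) = op (presented_eval x) (presented_eval y).
Proof. by rewrite [LHS]presented_eval_pi word_eval_cat. Qed.

Lemma presented_eval_gen i : presented_eval (presented_gen rels i) = h (i, false).
Proof. by rewrite [LHS]presented_eval_pi /= opm1. Qed.

Lemma presented_eval_genV i :
  presented_eval (presented_gen rels i)^-1 = h (i, true).
Proof.
rewrite -[LHS]op1m -{1}(hV (i, true)) -opA /inv_letter /=.
by rewrite -presented_eval_gen -presented_evalM mulgV presented_eval1 opm1.
Qed.

End Evaluation.

Section Words.
Variables (n : nat) (rels : set (word n * word n)).

Lemma presented_genX i k :
  presented_gen rels i ^+ k = presented_pi rels (nseq k (i, false)).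
Proof.
by elim: k => [//|k IH]; rewrite expgS IH [LHS]presented_mul_pi.
Qed.

(** Inverse letters must be treated on their own, since the properties proved
    by this induction need not be visibly stable under inversion. *)
Lemma presented_gen_ind (P : presented_group rels -> Prop) :
  P 1 -> (forall i x, P x -> P (presented_gen rels i * x)) ->
  (forall i x, P x -> P ((presented_gen rels i)^-1 * x)) -> forall x, P x.
Proof.
move=> P1 PM PV; elim/presented_ind; elim=> [|[i b] w IH]; first exact: P1.
have -> : presented_pi rels ((i, b) :: w) =
    presented_pi rels [:: (i, b)] * presented_pi rels w.
  by rewrite [RHS]presented_mul_pi.
have VE : (presented_gen rels i)^-1 = presented_pi rels [:: (i, true)].
  apply: (mulgI (presented_gen rels i)); rewrite mulgV [RHS]presented_mul_pi.
  by apply/presented_piP/word_eq_sym/(word_eq_cancel rels [::] (i, false) [::]).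
by case: b; rewrite -?VE; [exact: PV|exact: PM].
Qed.

End Words.

(** * The commutator subgroup of < a, b ; a^p = b^t > *)

Lemma ord2_ind (P : 'I_2 -> Prop) : P 0%R -> P 1%R -> forall i, P i.
Proof.
move=> P0 P1 [[|[|//]] i2].
  by rewrite (_ : Ordinal i2 = 0%R) //; exact: val_inj.
by rewrite (_ : Ordinal i2 = 1%R) //; exact: val_inj.
Qed.

Section GptCommutator.
Variables (p t : nat).
Hypotheses (p_gt0 : (0 < p)%N) (t_gt0 : (0 < t)%N).
Local Notation a := (Gpt_gen p t 0%R).
Local Notation b := (Gpt_gen p t 1%R).

Lemma Gpt_relation : a ^+ p = b ^+ t.
Proof.
rewrite !presented_genX; apply/presented_piP.
by have := @word_eq_rel 2 (Gpt_rels p t) [::] _ _ [::] erefl; rewrite !cats0.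
Qed.

Lemma Gpt_central (x : Gpt p t) : commute (a ^+ p) x.
Proof.
have ca i : commute (a ^+ p) (Gpt_gen p t i).
  elim/ord2_ind: i; first exact/commute_sym/commuteX.
  by rewrite Gpt_relation; exact/commute_sym/commuteX.
elim/presented_gen_ind: x => [|i x IH|i x IH]; first exact: commute1.
  by apply: commuteM => //; exact: ca.
by apply: commuteM => //; apply: commuteV; exact: ca.
Qed.

Definition Gpt_commutators : seq (Gpt p t) :=
  [seq [~ a ^+ i, b ^+ j] | i <- iota 1 p.-1, j <- iota 1 t.-1].

Lemma size_Gpt_commutators : size Gpt_commutators = (p.-1 * t.-1)%N.
Proof. by rewrite size_allpairs !size_iota. Qed.

Local Notation N := (subgroup_generated [set` Gpt_commutators]).

(** The central element a^p = b^t reduces the exponents modulo p and t. *)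
Lemma Gpt_commutators_gen i j : N [~ a ^+ i, b ^+ j].
Proof.
have [N1 NM NV] := subgroup_generated_is_subgroup [set` Gpt_commutators].
have cpow k x : commute x (a ^+ p ^+ k).
  by apply: commuteX; apply: commute_sym; exact: Gpt_central.
have aE : a ^+ i = a ^+ (i %% p) * a ^+ p ^+ (i %/ p).
  by rewrite -expgnA -expgnDr {1}(divn_eq i p) addnC mulnC.
have bE : b ^+ j = b ^+ (j %% t) * a ^+ p ^+ (j %/ t).
  by rewrite Gpt_relation -expgnA -expgnDr {1}(divn_eq j t) addnC mulnC.
have -> : [~ a ^+ i, b ^+ j] = [~ a ^+ (i %% p), b ^+ (j %% t)].
  rewrite aE bE commMgJ commgMJ.
  have comm1 x k : [~ x, a ^+ p ^+ k] = 1 by apply/eqP/commgP; exact: cpow.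
  have comm1' x k : [~ a ^+ p ^+ k, x] = 1 by rewrite -invgR comm1 invg1.
  by rewrite comm1 comm1' mul1g mulg1 !(conjgE, (cpow _ _), mulKg).
have [/eqP ->|i0] := boolP (i %% p == 0)%N; first by rewrite expg0 comm1g.
have [/eqP ->|j0] := boolP (j %% t == 0)%N; first by rewrite expg0 commg1.
apply: sub_gen_smallest; apply/allpairsP; exists (i %% p, j %% t)%N; split=> //=.
  by rewrite mem_iota; have := ltn_pmod i p_gt0; lia.
by rewrite mem_iota; have := ltn_pmod j t_gt0; lia.
Qed.

(** A conjugate of [~ a^i, b^j] by [a] or [b] is a product of such
    commutators, by the expansions of [~ xy, z] and [~ x, yz]; conjugation by
    a^-1 or b^-1 agrees with conjugation by a positive power, because a^p = b^t
    is central. *)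
Lemma Gpt_commutators_normal x y : N x -> N (x ^ y).
Proof.
have [N1 NM NV] := subgroup_generated_is_subgroup [set` Gpt_commutators].
have step (c : Gpt p t) : (forall i j, N ([~ a ^+ i, b ^+ j] ^ c)) ->
    forall x, N x -> N (x ^ c).
  move=> Nc; suff : N `<=` [set x | N (x ^ c)] by exact.
  apply: smallest_sub; last by move=> _ /allpairsP[[i j] [_ _ ->]]; exact: Nc.
  split=> [|z w Nz Nw|z Nz] /=; rewrite ?conj1g // ?conjMg ?conjVg; [exact: NM|exact: NV].
have Na : forall x, N x -> N (x ^ a).
  apply: (step a) => i j; rewrite -(mulgK [~ a, b ^+ j] (_ ^ a)) -commMgJ; apply: NM.
    by rewrite -expgSr; exact: Gpt_commutators_gen.
  by apply: NV; exact: (Gpt_commutators_gen 1 j).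
have Nb : forall x, N x -> N (x ^ b).
  apply: (step b) => i j; rewrite -(mulKg [~ a ^+ i, b] (_ ^ b)) -commgMJ; apply: NM.
    by apply: NV; exact: (Gpt_commutators_gen i 1).
  by rewrite -expgSr; exact: Gpt_commutators_gen.
have NX (c : Gpt p t) k : (forall x, N x -> N (x ^ c)) ->
    forall x, N x -> N (x ^ c ^+ k).
  move=> Nc; elim: k => [|k IH] z Nz; first by rewrite expg0 conjg1.
  by rewrite expgSr conjgM; apply: Nc; exact: IH.
have NVc (c : Gpt p t) k : (0 < k)%N -> c ^+ k = a ^+ p ->
    (forall x, N x -> N (x ^ c)) -> forall x, N x -> N (x ^ c^-1).
  move=> k0 ck Nc z Nz.
  have -> : c^-1 = c ^+ k.-1 * (a ^+ p)^-1.
    by rewrite -ck -{2}(prednK k0) expgS invgM mulVKg.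
  rewrite conjgM; rewrite (_ : (z ^ (c ^+ k.-1)) ^ (a ^+ p)^-1 = z ^ (c ^+ k.-1)).
    exact: NX.
  by apply/conjg_fixP/commgP; apply: commuteV; apply: commute_sym; exact: Gpt_central.
elim/presented_gen_ind: y x => [x|i y IH x|i y IH x] Nx; first by rewrite conjg1.
  by rewrite conjgM; apply: IH; elim/ord2_ind: i; [exact: Na|exact: Nb].
rewrite conjgM; apply: IH; elim/ord2_ind: i; first exact: (NVc a p).
by apply: (NVc b t) => //; rewrite Gpt_relation.
Qed.

(** The images of [a] and [b] commute modulo the normal subgroup generated by
    these commutators, so the quotient is abelian. *)
Lemma Gpt_commutator_subgroup : N = @commutator_subgroup (Gpt p t).
Proof.
have [N1 NM NV] := subgroup_generated_is_subgroup [set` Gpt_commutators].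
apply/seteqP; split; apply: subgroup_generatedS.
  move=> _ /allpairsP[[i j] [_ _ ->]]; apply: sub_gen_smallest.
  by exists (a ^+ i), (b ^+ j).
have extend (c : Gpt p t) : (forall i, N [~ Gpt_gen p t i, c]) -> forall x, N [~ x, c].
  move=> Nc; elim/presented_gen_ind => [|i x Nx|i x Nx]; first by rewrite comm1g.
    by rewrite commMgJ; apply: NM => //; apply: Gpt_commutators_normal; exact: Nc.
  rewrite commMgJ; apply: NM => //; apply: Gpt_commutators_normal.
  have := commMgJ (Gpt_gen p t i)^-1 (Gpt_gen p t i) c.
  rewrite mulVg comm1g => /esym/eqP; rewrite mulg_eq1 => /eqP E.
  rewrite -[X in N X](conjgK (Gpt_gen p t i)); apply: Gpt_commutators_normal.
  by rewrite E; apply: NV; exact: Nc.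
have Nab : N [~ a, b] by exact: (Gpt_commutators_gen 1 1).
have Ngen i x : N [~ x, Gpt_gen p t i].
  apply: extend => j; elim/ord2_ind: i; elim/ord2_ind: j => //.
  - by rewrite commgg.
  - by rewrite -invgR; exact: NV.
  - by rewrite commgg.
move=> _ [x [y ->]]; apply: extend => i; rewrite -invgR; apply: NV; exact: Ngen.
Qed.

End GptCommutator.

(** * The rank of the commutator subgroup *)

Section AffineAction.
Variables (p' t' : nat).
Local Notation p := p'.+1.
Local Notation t := t'.+1.
Local Notation V := 'M[rat]_(p, t).
Local Notation a := (Gpt_gen p t 0%R).
Local Notation b := (Gpt_gen p t 1%R).
Local Open Scope ring_scope.

Definition shift (k : 'I_p) (l : 'I_t) (m : V) : V :=
  \matrix_(i, j) m (i + k) (j + l).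

Lemma shift_shift k l k' l' m :
  shift k l (shift k' l' m) = shift (k + k') (l + l') m.
Proof. by apply/matrixP => i j; rewrite !mxE !addrA. Qed.

Lemma shift0 m : shift 0 0 m = m.
Proof. by apply/matrixP => i j; rewrite !mxE !addr0. Qed.

Lemma Zp_mulrn_id n : (inZp 1 : 'I_n.+1) *+ n.+1 = 0.
Proof. by rewrite Zp_mulrn; apply: val_inj; rewrite /= modnMl. Qed.

Let U : V := delta_mx 0 0.

(** [a] shifts the rows about the fixed point [U] and [b] shifts the columns
    about the fixed point 0, so both a^p and b^t act trivially. *)
Definition letter_act (l : 'I_2 * bool) (m : V) : V :=
  if l.1 == 0
  then shift (if l.2 then - inZp 1 else inZp 1) 0 (m - U) + U
  else shift 0 (if l.2 then - inZp 1 else inZp 1) m.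

Definition Gpt_act : Gpt p t -> V -> V :=
  @presented_eval 2 _ (V -> V) (fun f g => f \o g) id letter_act.

Let letter_actV l : letter_act l \o letter_act (inv_letter l) = id.
Proof.
apply/funext => m; rewrite /letter_act /=; case: l => i c /=; case: (i == 0).
  by rewrite addrK shift_shift addr0; case: c; rewrite /= ?subrr ?addNr shift0 subrK.
by rewrite shift_shift addr0; case: c; rewrite /= ?subrr ?addNr shift0.
Qed.

Let word_eval_nseq l k :
  word_eval (fun f g : V -> V => f \o g) id letter_act (nseq k l)
  = iter k (letter_act l).
Proof. by elim: k => [//|k IH]; apply/funext => m /=; rewrite IH. Qed.

Let iter_a k m : iter k (letter_act (0, false)) m = shift (inZp 1 *+ k) 0 (m - U) + U.
Proof.
elim: k => [|k IH]; first by rewrite mulr0n shift0 subrK.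
by rewrite iterS IH /letter_act /= addrK shift_shift addr0 mulrS.
Qed.

Let iter_b k m : iter k (letter_act (1, false)) m = shift 0 (inZp 1 *+ k) m.
Proof.
elim: k => [|k IH]; first by rewrite mulr0n shift0.
by rewrite iterS IH /letter_act /= shift_shift addr0 mulrS.
Qed.

Let letter_act_rels l r : Gpt_rels p t (l, r) ->
  word_eval (fun f g : V -> V => f \o g) id letter_act l =
  word_eval (fun f g : V -> V => f \o g) id letter_act r.
Proof.
move=> E; rewrite (congr1 fst E : l = _) (congr1 snd E : r = _) !word_eval_nseq.
apply/funext => m; rewrite -/p -/t.
by rewrite iter_a iter_b !Zp_mulrn_id !shift0 subrK.
Qed.

Let opA : associative (fun f g : V -> V => f \o g). Proof. by []. Qed.

Lemma Gpt_act1 m : Gpt_act 1%g m = m.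
Proof. by rewrite /Gpt_act presented_eval1. Qed.

Lemma Gpt_actM x y m : Gpt_act (x * y)%g m = Gpt_act x (Gpt_act y m).
Proof. by rewrite /Gpt_act presented_evalM. Qed.

Lemma Gpt_act_aX k m : Gpt_act (a ^+ k)%g m = shift (inZp 1 *+ k) 0 (m - U) + U.
Proof. by rewrite /Gpt_act presented_genX presented_eval_pi // word_eval_nseq iter_a. Qed.

Lemma Gpt_act_bX k m : Gpt_act (b ^+ k)%g m = shift 0 (inZp 1 *+ k) m.
Proof. by rewrite /Gpt_act presented_genX presented_eval_pi // word_eval_nseq iter_b. Qed.

Lemma Gpt_actK x m : Gpt_act x^-1%g (Gpt_act x m) = m.
Proof. by rewrite -Gpt_actM mulVg Gpt_act1. Qed.

Definition commutator_vector (k : 'I_p) (l : 'I_t) : V :=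
  U - shift (- k) 0 U - shift 0 (- l) U + shift (- k) (- l) U.

Lemma Gpt_act_commutator i j m :
  Gpt_act [~ a ^+ i, b ^+ j]%g m
  = m + commutator_vector (inZp 1 *+ i) (inZp 1 *+ j).
Proof.
set k := inZp 1 *+ i; set l := inZp 1 *+ j.
have inj x : injective (Gpt_act x) by exact: can_inj (Gpt_actK x).
apply: (inj (b ^+ j * a ^+ i)%g); rewrite -Gpt_actM -commgC.
rewrite !Gpt_actM !Gpt_act_aX !Gpt_act_bX -/k -/l /commutator_vector.
apply/matrixP => x y; rewrite !mxE !(addr0, addrK).
by ring.
Qed.

Definition acts_by_translations (W : {vspace V}) : set (Gpt p t) :=
  [set x | exists2 w, w \in W & forall m, Gpt_act x m = m + w].

Lemma acts_by_translations_subgroup W : is_subgroup (acts_by_translations W).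
Proof.
split.
- by exists 0 => [|m]; rewrite ?mem0v // Gpt_act1 addr0.
- move=> x y [v vW xv] [w wW yw]; exists (w + v) => [|m]; first exact: memvD.
  by rewrite Gpt_actM yw xv addrA.
- move=> x [v vW xv]; exists (- v) => [|m]; first by rewrite memvN.
  by rewrite -{1}[m](subrK v) -xv Gpt_actK.
Qed.

(** For 0 < i < p and 0 < j < t the translation vector of [~ a^i, b^j] is a sum of four
    elementary matrices with signs, at the positions (0, 0), (i, 0), (0, j) and
    (i, j); only the last survives when the row and the column of index 0 are
    dropped. *)
Definition inner_block (m : V) : 'M[rat]_(p', t') :=
  \matrix_(i, j) m (lift ord0 i) (lift ord0 j).

Fact inner_block_is_linear : linear inner_block.
Proof. by move=> c u v; apply/matrixP => i j; rewrite !mxE. Qed.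
HB.instance Definition _ := GRing.isLinear.Build rat V 'M[rat]_(p', t') _
  inner_block inner_block_is_linear.

Lemma inner_block_commutator_vector (i : 'I_p') (j : 'I_t') :
  inner_block (commutator_vector (inZp 1 *+ i.+1) (inZp 1 *+ j.+1)) = delta_mx i j.
Proof.
have oneE n (k : 'I_n) : (inZp 1 : 'I_n.+1) *+ k.+1 = lift ord0 k.
  rewrite Zp_mulrn; apply: val_inj; rewrite /= modnMml mul1n modn_small //.
  by rewrite ltnS ltn_ord.
rewrite !oneE; apply/matrixP => x y; rewrite !mxE /=.
have nz n (k : 'I_n) : (lift ord0 k == 0 :> 'I_n.+1) = false by [].
rewrite !addr0 ![(lift _ _ - _) == _]subr_eq0 !(inj_eq lift_inj) !nz.
by rewrite !andbF /= !subr0 add0r.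
Qed.

(** If the commutator subgroup is generated by [s], the vectors by which the
    elements of [s] translate span a space whose inner blocks fill all matrices
    of size p' * t'. *)
Lemma size_generators_commutator_subgroup (s : seq (Gpt p t)) :
  subgroup_generated [set` s] = @commutator_subgroup (Gpt p t) ->
  (p' * t' <= size s)%N.
Proof.
move=> sG.
have N_trans : @commutator_subgroup (Gpt p t) `<=` acts_by_translations fullv.
  rewrite -Gpt_commutator_subgroup //; apply: smallest_sub.
    exact: acts_by_translations_subgroup.
  move=> _ /allpairsP[[i j] [_ _ ->]]; eexists; first exact: memvf.
  exact: Gpt_act_commutator.
pose W := <<[seq Gpt_act x 0 | x <- s]>>%VS.
have W_trans : @commutator_subgroup (Gpt p t) `<=` acts_by_translations W.
  rewrite -sG; apply: smallest_sub; first exact: acts_by_translations_subgroup.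
  move=> x xs; have [w _ xw] : acts_by_translations fullv x.
    by apply: N_trans; rewrite -sG; exact: sub_gen_smallest.
  exists w => //; apply: memv_span; apply/mapP; exists x => //.
  by rewrite xw add0r.
have full : (linfun inner_block @: W = fullv)%VS.
  apply/vspaceP => m; rewrite memvf [m]matrix_sum_delta.
  apply: memv_suml => i _; apply: memv_suml => j _; apply: memvZ.
  have [|w wW E] := W_trans [~ a ^+ i.+1, b ^+ j.+1]%g.
    by apply: sub_gen_smallest; do 2 eexists.
  rewrite -inner_block_commutator_vector -[inner_block _]lfunE memv_img //.
  by have := E 0; rewrite Gpt_act_commutator !add0r => ->.
have := dim_span [seq Gpt_act x 0 | x <- s]; rewrite size_map; apply: leq_trans.
rewrite -/W -(limg_ker_dim (linfun inner_block) W) full dimvf.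
exact: leq_addl.
Qed.

End AffineAction.

Lemma Gpt_commutator_rank p t : (0 < p)%N -> (0 < t)%N ->
  group_rank (@commutator_subgroup (Gpt p t)) (p.-1 * t.-1).
Proof.
case: p t => [//|p] [//|t] _ _; split => [|s].
  exists (Gpt_commutators p.+1 t.+1); rewrite size_Gpt_commutators.
  by split => //; exact: Gpt_commutator_subgroup.
exact: size_generators_commutator_subgroup.
Qed.

Local Close Scope group_scope.

(** * Polynomial functions *)

Section PolynomialFunctions.
Local Open Scope ring_scope.
Variable F : numFieldType.

(** The algebra of functions generated by the coordinates [X]. The points may be
    row vectors, sequences of parameters, or scalars, according to [X]; see the
    three coordinate systems below. *)
Inductive polyfun (T I : Type) (X : I -> T -> F) : (T -> F) -> Prop :=
| polyfun_const c : polyfun X (fun=> c)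
| polyfun_coord i : polyfun X (X i)
| polyfunD f g : polyfun X f -> polyfun X g -> polyfun X (fun v => f v + g v)
| polyfunM f g : polyfun X f -> polyfun X g -> polyfun X (fun v => f v * g v).

Definition row_coord (N : nat) (i : 'I_N) (v : 'rV[F]_N) : F := v ord0 i.

(** Points of affine n-space are sequences of which only the first n terms are
    read. *)
Definition aff_coord (n : nat) (i : 'I_n) (u : nat -> F) : F := u i.

Definition line_coord (_ : unit) (s : F) : F := s.

Section Closure.
Variables (T I : Type) (X : I -> T -> F).

Lemma polyfun_ext f g : f =1 g -> polyfun X f -> polyfun X g.
Proof. by move=> /funext ->. Qed.

Lemma polyfunN f : polyfun X f -> polyfun X (fun v => - f v).
Proof.
move=> Xf; apply: (polyfun_ext (f := fun v => -1 * f v)) => [v|].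
  by rewrite mulN1r.
by apply: polyfunM => //; exact: polyfun_const.
Qed.

Lemma polyfunB f g : polyfun X f -> polyfun X g -> polyfun X (fun v => f v - g v).
Proof. by move=> Xf Xg; apply: polyfunD => //; exact: polyfunN. Qed.

Lemma polyfunX f k : polyfun X f -> polyfun X (fun v => f v ^+ k).
Proof.
move=> Xf; elim: k => [|k IH]; first exact: polyfun_const.
by apply: polyfun_ext (polyfunM Xf IH) => v; rewrite exprS.
Qed.

Lemma polyfun_sum (J : Type) (r : seq J) (f : J -> T -> F) :
  (forall j, polyfun X (f j)) -> polyfun X (fun v => \sum_(j <- r) f j v).
Proof.
move=> Xf; elim: r => [|j r IH].
  by apply: polyfun_ext (polyfun_const X 0) => v; rewrite big_nil.
by apply: polyfun_ext (polyfunD (Xf j) IH) => v; rewrite big_cons.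
Qed.

Lemma polyfun_prod (J : Type) (r : seq J) (f : J -> T -> F) :
  (forall j, polyfun X (f j)) -> polyfun X (fun v => \prod_(j <- r) f j v).
Proof.
move=> Xf; elim: r => [|j r IH].
  by apply: polyfun_ext (polyfun_const X 1) => v; rewrite big_nil.
by apply: polyfun_ext (polyfunM (Xf j) IH) => v; rewrite big_cons.
Qed.

Lemma polyfun_comp (T' I' : Type) (X' : I' -> T' -> F) (phi : T' -> T) f :
  (forall i, polyfun X' (fun v => X i (phi v))) -> polyfun X f ->
  polyfun X' (fun v => f (phi v)).
Proof.
by move=> Xphi; elim=> {f} [c|i|f g _ IHf _ IHg|f g _ IHf _ IHg];
  [exact: polyfun_const|exact: Xphi|exact: polyfunD|exact: polyfunM].
Qed.

End Closure.

Section Meval.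
Import -(notations) mpoly.

Lemma polyfun_meval N (f : 'rV[F]_N -> F) :
  polyfun (@row_coord N) f <-> exists q, f = fun v => mpoly.meval (v ord0) q.
Proof.
split.
  elim=> {f} [c|i|f g _ [p ->] _ [q ->]|f g _ [p ->] _ [q ->]].
  - by exists (mpoly.mpolyC N c); apply/funext => v; rewrite mpoly.mevalC.
  - exists (mpoly.mpolyX F (mpoly.mnm1 i)); apply/funext => v.
    by rewrite mpoly.mevalXU.
  - by exists (p + q); apply/funext => v; rewrite mpoly.mevalD.
  - by exists (p * q); apply/funext => v; rewrite mpoly.mevalM.
move=> [q ->].
apply: (polyfun_ext (f := fun v : 'rV[F]_N => \sum_(m <- mpoly.msupp q)
    mpoly.mcoeff m q * \prod_i v ord0 i ^+ mpoly.fun_of_multinom m i)) => [v|].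
  by rewrite mpoly.mevalE.
apply: polyfun_sum => m; apply: polyfunM; first exact: polyfun_const.
apply: polyfun_prod => i; apply: polyfunX; exact: (polyfun_coord _ i).
Qed.

End Meval.

Lemma polyfun_line (f : F -> F) :
  polyfun line_coord f -> exists q : {poly F}, f = horner q.
Proof.
elim=> {f} [c|i|f g _ [p ->] _ [q ->]|f g _ [p ->] _ [q ->]].
- by exists c%:P; apply/funext => s; rewrite hornerC.
- by exists 'X; apply/funext => s; rewrite hornerX.
- by exists (p + q); apply/funext => s; rewrite hornerD.
- by exists (p * q); apply/funext => s; rewrite hornerM.
Qed.

Lemma horner_eq0 (q : {poly F}) : (forall s, q.[s] = 0) -> q = 0.
Proof.
move=> q0; apply: (@roots_geq_poly_eq0 F q [seq i%:R | i <- iota 0 (size q)]).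
- by apply/allP => s _; apply/rootP; exact: q0.
- rewrite map_inj_in_uniq ?iota_uniq // => i j _ _ /eqP.
  by rewrite eqr_nat => /eqP.
- by rewrite size_map size_iota.
Qed.

(** Over an infinite field, polynomial functions form an integral domain. *)
Lemma polyfun_line_domain (f g : F -> F) :
  polyfun line_coord f -> polyfun line_coord g ->
  (forall s, f s * g s = 0) -> (forall s, f s = 0) \/ (forall s, g s = 0).
Proof.
move=> /polyfun_line[p ->] /polyfun_line[q ->] pq.
have /eqP : p * q = 0 by apply: horner_eq0 => s; rewrite hornerM.
by rewrite mulf_eq0 => /orP[/eqP ->|/eqP ->]; [left|right] => s; rewrite horner0.
Qed.

(** Two functions that are nonzero at [u] and at [w] are both nonzero at some
    point of the line through [u] and [w]. *)
Lemma polyfun_aff_domain n (f g : (nat -> F) -> F) :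
  polyfun (@aff_coord n) f -> polyfun (@aff_coord n) g ->
  (forall u, f u * g u = 0) -> (forall u, f u = 0) \/ (forall u, g u = 0).
Proof.
move=> Pf Pg fg; apply: contrapT => /not_orP[/existsNP[u fu] /existsNP[w gw]].
pose line (s : F) (i : nat) := u i + s * (w i - u i).
have Pl i : polyfun line_coord (fun s => aff_coord (i : 'I_n) (line s)).
  apply: polyfunD; first exact: polyfun_const.
  by apply: polyfunM; [exact: (polyfun_coord _ tt)|exact: polyfun_const].
have := polyfun_line_domain (polyfun_comp Pl Pf) (polyfun_comp Pl Pg) (fun s => fg _).
have l0 : line 0 = u by apply/funext => i; rewrite /line mul0r addr0.
have l1 : line 1 = w by apply/funext => i; rewrite /line mul1r addrC subrK.
by case=> [/(_ 0)|/(_ 1)]; rewrite ?l0 ?l1.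
Qed.

End PolynomialFunctions.

(** * Zariski-closed and irreducible sets *)

Section Zariski.
Local Open Scope ring_scope.
Variables (F : numFieldType) (N : nat).
Implicit Types (A Z : set 'rV[F]_N) (f g : 'rV[F]_N -> F).
Local Notation rowfun := (polyfun (@row_coord F N)).

Lemma zariski_closed_forall (I : Type) (A : I -> set 'rV[F]_N) :
  (forall i, zariski_closed (A i)) -> zariski_closed [set v | forall i, A i v].
Proof.
move=> /choice[S SA].
exists [set q | exists i, S i q]; apply/seteqP; split => v /= Av.
  by move=> q [i Sq]; have := Av i; rewrite SA; exact.
by move=> i; rewrite SA => q Sq; apply: Av; exists i.
Qed.

Lemma zariski_closed_zero f : rowfun f -> zariski_closed [set v | f v = 0].
Proof.
move=> /polyfun_meval[q ->]; exists [set q].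
by apply/seteqP; split => v /= => [qv _ ->|]; [exact: qv|exact].
Qed.

Lemma zariski_closed_eq f g :
  rowfun f -> rowfun g -> zariski_closed [set v | f v = g v].
Proof.
move=> Pf Pg; rewrite (_ : mkset _ = [set v | f v - g v = 0]).
  by apply: zariski_closed_zero; exact: polyfunB.
by apply/seteqP; split => v /= => [->|/eqP]; rewrite ?subrr // subr_eq0 => /eqP.
Qed.

Lemma zariski_closedI A B :
  zariski_closed A -> zariski_closed B -> zariski_closed (A `&` B).
Proof.
move=> cA cB; rewrite (_ : _ `&` _ =
    [set v | forall i : bool, (if i then A else B) v]).
  by apply: zariski_closed_forall => -[].
by apply/seteqP; split => v => [[Av Bv] []|AB] //; split; [exact: (AB true)|exact: (AB false)].
Qed.

Lemma zariski_closed_separate A v : zariski_closed A -> ~ A v ->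
  exists f, [/\ rowfun f, forall u, A u -> f u = 0 & f v <> 0].
Proof.
move=> [S ->] /existsNP[q /not_implyP[Sq qv]].
exists (fun u => mpoly.meval (u ord0) q); split=> //.
  by apply/polyfun_meval; exists q.
by move=> u; exact.
Qed.

Lemma zariski_closedU A B :
  zariski_closed A -> zariski_closed B -> zariski_closed (A `|` B).
Proof.
move=> cA cB; pose I := {fg : ('rV[F]_N -> F) * ('rV[F]_N -> F) |
  [/\ rowfun fg.1, rowfun fg.2, forall v, A v -> fg.1 v = 0 & forall v, B v -> fg.2 v = 0]}.
rewrite (_ : _ `|` _ = [set v | forall i : I, (sval i).1 v * (sval i).2 v = 0]).
  apply: zariski_closed_forall => -[[f g] [Pf Pg _ _]] /=.
  by apply: zariski_closed_zero; exact: polyfunM.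
apply/seteqP; split => [v [Av|Bv] [[f g] [/= _ _ fA gB]]|v vfg].
- by rewrite fA ?mul0r.
- by rewrite gB ?mulr0.
apply: contrapT => /not_orP[/(zariski_closed_separate cA)[f [Pf fA fv]]].
move=> /(zariski_closed_separate cB)[g [Pg gB gv]].
have /= /eqP := vfg (exist _ (f, g) (And4 Pf Pg fA gB)).
by rewrite mulf_eq0 => /orP[/eqP|/eqP].
Qed.

(** Absorbing the closed sets one at a time into [D] reduces the claim to the
    union of two sets. *)
Lemma irreducible_finite_union (I : eqType) (s : seq I) (E : I -> set 'rV[F]_N) D Z :
  zariski_irreducible Z -> zariski_closed D ->
  (forall i, i \in s -> zariski_closed (E i)) ->
  Z `<=` [set v | D v \/ exists2 i, i \in s & E i v] ->
  Z `<=` D \/ exists2 i, i \in s & Z `<=` E i.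
Proof.
move=> Zirr; elim: s D => [|k s IH] D cD cE ZDE.
  by left=> v /ZDE[|[]].
have cEk : zariski_closed (E k) by apply: cE; rewrite mem_head.
have {}IH : Z `<=` D `|` E k \/ exists2 i, i \in s & Z `<=` E i.
  apply: IH => [|i si|v Zv]; first exact: zariski_closedU.
    by apply: cE; rewrite in_cons si orbT.
  have [Dv|[j]] := ZDE v Zv; first by left; left.
  by rewrite in_cons => /orP[/eqP ->|sj Ej]; [left; right|right; exists j].
case: IH => [ZDEk|[i si ZEi]]; last by right; exists i => //; rewrite in_cons si orbT.
have [ZD|ZEk] := Zirr.2 _ _ cD cEk ZDEk; first by left.
by right; exists k => //; rewrite mem_head.
Qed.

Lemma irreducible_mul_eq0 Z f g : zariski_irreducible Z -> rowfun f -> rowfun g ->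
  (forall v, Z v -> f v * g v = 0) ->
  (forall v, Z v -> f v = 0) \/ (forall v, Z v -> g v = 0).
Proof.
move=> [_ Zirr] Pf Pg fg.
have := Zirr _ _ (zariski_closed_zero Pf) (zariski_closed_zero Pg); apply.
move=> v /fg/eqP; rewrite mulf_eq0 => /orP[/eqP ?|/eqP ?]; first by left.
by right.
Qed.

(** The image of [phi] is a Zariski-dense subset of [Z]. *)
Definition dominates (n : nat) (phi : (nat -> F) -> 'rV[F]_N) Z : Prop :=
  [/\ forall i, polyfun (@aff_coord F n) (fun u => phi u ord0 i),
      forall u, Z (phi u)
    & forall f, rowfun f -> (forall u, f (phi u) = 0) -> forall v, Z v -> f v = 0].

Lemma dominates_irreducible n phi Z : dominates n phi Z -> zariski_irreducible Z.
Proof.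
move=> [Pphi Zphi dense]; split; first by exists (phi (fun=> 0)).
move=> Z1 Z2 c1 c2 Z12; apply: contrapT => /not_orP[].
move=> /existsNP[v1 /not_implyP[Zv1 Z1v1]] /existsNP[v2 /not_implyP[Zv2 Z2v2]].
have [f1 [Pf1 f10 f1v]] := zariski_closed_separate c1 Z1v1.
have [f2 [Pf2 f20 f2v]] := zariski_closed_separate c2 Z2v2.
have : (forall u, f1 (phi u) = 0) \/ (forall u, f2 (phi u) = 0).
  apply: (polyfun_aff_domain (polyfun_comp Pphi Pf1) (polyfun_comp Pphi Pf2)).
  move=> u; case: (Z12 _ (Zphi u)) => [/f10 ->|/f20 ->]; first by rewrite mul0r.
  by rewrite mulr0.
by case=> [/(dense _ Pf1)/(_ _ Zv1)|/(dense _ Pf2)/(_ _ Zv2)].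
Qed.

(** Every point of [Z] is the value at 0 of a polynomial curve that stays in the
    image of [phi] away from the zeros of a nonzero polynomial. *)
Lemma dominates_curves n (phi : (nat -> F) -> 'rV[F]_N) Z :
  (forall i, polyfun (@aff_coord F n) (fun u => phi u ord0 i)) ->
  (forall u, Z (phi u)) ->
  (forall v, Z v -> exists (gam : F -> 'rV[F]_N) (q : F -> F),
     [/\ forall i, polyfun (@line_coord F) (fun s => gam s ord0 i), gam 0 = v,
         polyfun (@line_coord F) q, exists s, q s <> 0
       & forall s, q s <> 0 -> exists u, gam s = phi u]) ->
  dominates n phi Z.
Proof.
move=> Pphi Zphi curve; split=> // f Pf f0 v /curve[gam [q [Pgam <- Pq [s0 qs0] qgam]]].
have fq s : f (gam s) * q s = 0.
  have [->|/eqP/qgam[u ->]] := eqVneq (q s) 0; first by rewrite mulr0.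
  by rewrite f0 mul0r.
by have [/(_ 0)|/(_ s0)] := polyfun_line_domain (polyfun_comp Pgam Pf) Pq fq.
Qed.

End Zariski.

(** * Algebraic independence bounds the length of chains *)

Section Independence.
Local Open Scope ring_scope.
Variable F : numFieldType.

(** The value of the polynomial with coefficients [c], of degree less than [k]
    in each variable, at the functions [ys]; [c] is indexed by the list of
    exponents. *)
Fixpoint poly_value (T : Type) k (ys : seq (T -> F)) (c : seq nat -> F) (v : T) : F :=
  if ys is y :: ys' then \sum_(i < k) y v ^+ i * poly_value k ys' (fun s => c (nat_of_ord i :: s)) v
  else c [::].

Definition alg_independent (T : Type) (Z : set T) (ys : seq (T -> F)) : Prop :=
  forall k c, (forall v, Z v -> poly_value k ys c v = 0) ->
  forall s, size s = size ys -> all (fun i => i < k)%N s -> c s = 0.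

Lemma poly_value_eq0 (T : Type) k (ys : seq (T -> F)) c v :
  (forall s, size s = size ys -> all (fun i => i < k)%N s -> c s = 0) ->
  poly_value k ys c v = 0.
Proof.
elim: ys c => [|y ys IH] c c0 /=; first exact: c0.
rewrite big1 // => i _; rewrite IH ?mulr0 // => s ss sk.
by apply: c0 => /=; rewrite ?ss ?ltn_ord.
Qed.

Lemma polyfun_poly_value (T I : Type) (X : I -> T -> F) k ys c :
  (forall i, polyfun X (nth (fun=> 0) ys i)) -> polyfun X (poly_value k ys c).
Proof.
elim: ys c => [|y ys IH] c Py; first exact: polyfun_const.
apply: polyfun_sum => i; apply: polyfunM; first by apply: polyfunX; exact: (Py 0%N).
by apply: IH => j; exact: (Py j.+1).
Qed.

Lemma alg_independentS (T : Type) (Z Z' : set T) ys :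
  Z `<=` Z' -> alg_independent Z ys -> alg_independent Z' ys.
Proof. by move=> ZZ indep k c c0; apply: indep => v /ZZ; exact: c0. Qed.

Section Chains.
Variable N : nat.
Implicit Types Z : set 'rV[F]_N.
Local Notation rowfun := (polyfun (@row_coord F N)).

(** A relation between [f] and [ys] on [Z'], written as a polynomial in [f],
    restricts on [Z] to its constant coefficient, which is therefore zero; the
    rest is divisible by [f], and [f] cancels because [Z'] is irreducible. *)
Lemma alg_independent_cons Z Z' f ys :
  Z `<=` Z' -> zariski_irreducible Z' -> rowfun f ->
  (forall i, rowfun (nth (fun=> 0) ys i)) ->
  (forall v, Z v -> f v = 0) -> ~ (forall v, Z' v -> f v = 0) ->
  alg_independent Z ys -> alg_independent Z' (f :: ys).
Proof.
move=> ZZ' Z'irr Pf Pys fZ fZ' indep k c c0.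
suff claim n (d : nat -> seq nat -> F) :
    (forall v, Z' v -> \sum_(i < n) f v ^+ i * poly_value k ys (d i) v = 0) ->
    forall i s, (i < n)%N -> size s = size ys -> all (fun i => i < k)%N s -> d i s = 0.
  case=> [//|i s] [ss] /andP[ik sk].
  exact: (claim k (fun i s => c (i :: s)) c0).
elim: n d => [//|n IH] d d0.
have d00 s : size s = size ys -> all (fun i => i < k)%N s -> d 0%N s = 0.
  apply: indep => v Zv; have := d0 v (ZZ' _ Zv).
  rewrite big_ord_recl big1 /= ?addr0 ?expr0 ?mul1r // => i _.
  by rewrite fZ // expr0n mul0r.
have Psum : rowfun (fun v => \sum_(i < n) f v ^+ i * poly_value k ys (d i.+1) v).
  apply: polyfun_sum => i; apply: polyfunM; first exact: polyfunX.
  exact: polyfun_poly_value.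
have : forall v, Z' v -> f v * (\sum_(i < n) f v ^+ i * poly_value k ys (d i.+1) v) = 0.
  move=> v /d0; rewrite big_ord_recl /= poly_value_eq0 // mulr0 add0r => fd0.
  by rewrite -[RHS]fd0 mulr_sumr; apply: eq_bigr => i _; rewrite mulrA -exprS.
move=> /(irreducible_mul_eq0 Z'irr Pf Psum)[//|d1].
by case=> [|i] s; [move=> _; exact: d00|rewrite ltnS; exact: (IH (fun i => d i.+1))].
Qed.

(** Each step of the chain adds a function vanishing on the smaller set only. *)
Lemma chain_alg_independent d (Z : nat -> set 'rV[F]_N) :
  (forall i, (i <= d)%N -> zariski_closed (Z i) /\ zariski_irreducible (Z i)) ->
  (forall i, (i < d)%N -> Z i `<` Z i.+1) ->
  exists ys, [/\ size ys = d, forall i, rowfun (nth (fun=> 0) ys i)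
    & alg_independent (Z d) ys].
Proof.
elim: d => [|d IH] Zirr Zlt.
  exists [::]; split=> // [i|]; first by rewrite nth_nil; exact: polyfun_const.
  move=> k c c0 [|//] _ _; have [_ [[v Zv] _]] := Zirr 0%N isT.
  exact: c0 v Zv.
have [i id|i id|ys [szys Pys indep]] := IH; first by apply: Zirr; exact: leqW.
  by apply: Zlt; exact: leqW.
have [ZZ' ZZ] := Zlt d (leqnn _).
move/existsNP: ZZ => [v /not_implyP[Z'v Zv]].
have [f [Pf fZ fv]] := zariski_closed_separate (Zirr d (leqnSn _)).1 Zv.
exists (f :: ys); split=> [|[//|i]|]; [by rewrite /= szys|exact: Pys|].
refine (alg_independent_cons ZZ' _ Pf Pys fZ _ indep).
  by case: (Zirr d.+1 (leqnn _)).
by move=> /(_ v Z'v).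
Qed.

End Chains.

(** * The number of monomials bounds independence on affine space *)

Section Counting.
Variable n : nat.
Local Notation affine := (nat -> F).
Implicit Types f g : affine -> F.

Definition box_monomial e (al : {ffun 'I_n -> 'I_e.+1}) (u : affine) : F :=
  \prod_(i < n) u i ^+ al i.

(** Bounding the degree in each variable separately makes the monomials a
    function type, whose cardinality is a power. *)
Definition box_degree_le e f : Prop :=
  exists c : {ffun 'I_n -> 'I_e.+1} -> F,
    forall u, f u = \sum_al c al * box_monomial al u.

Lemma box_degree_ext e f g : f =1 g -> box_degree_le e f -> box_degree_le e g.
Proof. by move=> /funext ->. Qed.

Lemma box_degree_sum e (J : finType) (f : J -> affine -> F) :
  (forall j, box_degree_le e (f j)) -> box_degree_le e (fun u => \sum_j f j u).
Proof.
move=> /choice[c fc]; exists (fun al => \sum_j c j al) => u.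
under [RHS]eq_bigr do rewrite mulr_suml.
by rewrite exchange_big; apply: eq_bigr => j _; rewrite fc.
Qed.

Lemma box_degree_scale e a f :
  box_degree_le e f -> box_degree_le e (fun u => a * f u).
Proof.
move=> [c fc]; exists (fun al => a * c al) => u.
by rewrite fc mulr_sumr; apply: eq_bigr => al _; rewrite mulrA.
Qed.

Lemma box_degree_monomial e (m : 'I_n -> nat) :
  (forall i, m i <= e)%N -> box_degree_le e (fun u => \prod_(i < n) u i ^+ m i).
Proof.
move=> me; pose al0 : {ffun 'I_n -> 'I_e.+1} := [ffun i => inord (m i)].
exists (fun al => (al == al0)%:R) => u.
rewrite (bigD1 al0) //= eqxx mul1r [X in _ + X]big1 ?addr0 => [|al /negPf ->];
  last by rewrite mul0r.
by apply: eq_bigr => i _; rewrite ffunE inordK // ltnS.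
Qed.

Lemma box_degreeM e e' f g : box_degree_le e f -> box_degree_le e' g ->
  box_degree_le (e + e') (fun u => f u * g u).
Proof.
move=> [c fc] [d gd].
apply: (box_degree_ext (f := fun u => \sum_al \sum_be (c al * d be) *
    \prod_(i < n) u i ^+ (al i + be i))) => [u|].
  rewrite fc gd big_distrlr /=; apply: eq_bigr => al _; apply: eq_bigr => be _.
  rewrite mulrACA -big_split /=; congr (_ * _).
  by apply: eq_bigr => i _; rewrite exprD.
apply: box_degree_sum => al; apply: box_degree_sum => be; apply: box_degree_scale.
by apply: box_degree_monomial => i; rewrite leq_add // -ltnS ltn_ord.
Qed.

Lemma box_degree_const e a : box_degree_le e (fun=> a).
Proof.
apply: (box_degree_ext (f := fun u => a * \prod_(i < n) u i ^+ 0)) => [u|].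
  by rewrite big1 ?mulr1.
by apply: box_degree_scale; exact: box_degree_monomial.
Qed.

Lemma box_degreeW e e' f : (e <= e')%N -> box_degree_le e f -> box_degree_le e' f.
Proof.
move=> ee' fe; rewrite -(subnKC ee').
apply: (box_degree_ext (f := fun u => f u * 1)) => [u|]; first by rewrite mulr1.
by apply: box_degreeM => //; exact: box_degree_const.
Qed.

Lemma box_degreeX e f k : box_degree_le e f -> box_degree_le (k * e) (fun u => f u ^+ k).
Proof.
move=> fe; elim: k => [|k IH]; first exact: box_degree_const.
rewrite mulSn; apply: box_degree_ext (box_degreeM fe IH) => u.
by rewrite exprS.
Qed.

Lemma polyfun_box_degree f : polyfun (@aff_coord F n) f -> exists e, box_degree_le e f.
Proof.
elim=> {f} [c|i|f g _ [e fe] _ [e' ge]|f g _ [e fe] _ [e' ge]].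
- by exists 0%N; exact: box_degree_const.
- exists 1%N; apply: (box_degree_ext
    (f := fun u => \prod_(j < n) u j ^+ (j == i))) => [u|].
    by rewrite (bigD1 i) //= eqxx big1 ?mulr1 // => j /negPf ->.
  by apply: box_degree_monomial => j; case: eqP.
- exists (e + e')%N.
  apply: (box_degree_ext (f := fun u => \sum_(b : bool) (if b then f else g) u)).
    by move=> u; rewrite big_bool.
  by apply: box_degree_sum => -[]; [apply: box_degreeW fe|apply: box_degreeW ge];
    rewrite ?leq_addr ?leq_addl.
- by exists (e + e')%N; exact: box_degreeM.
Qed.

Lemma polyfuns_box_degree (ys : seq (affine -> F)) :
  (forall i, polyfun (@aff_coord F n) (nth (fun=> 0) ys i)) ->
  exists e, forall i, box_degree_le e (nth (fun=> 0) ys i).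
Proof.
elim: ys => [|y ys IH] Pys.
  by exists 0%N => i; rewrite nth_nil; exact: box_degree_const.
have [i|e ye] := IH; first exact: (Pys i.+1).
have [e' ye'] := polyfun_box_degree (Pys 0%N).
by exists (e + e')%N => -[|i]; [apply: box_degreeW ye'|apply: box_degreeW (ye i)];
  rewrite ?leq_addr ?leq_addl.
Qed.

Fixpoint monomial (T : Type) (ys : seq (T -> F)) (s : seq nat) (v : T) : F :=
  match ys, s with
  | y :: ys', i :: s' => y v ^+ i * monomial ys' s' v
  | _, _ => 1
  end.

Lemma poly_valueE (T : Type) k (ys : seq (T -> F)) c v :
  poly_value k ys c v = \sum_(s : (size ys).-tuple 'I_k)
    c (map (@nat_of_ord k) s) * monomial ys (map (@nat_of_ord k) s) v.
Proof.
elim: ys c => [|y ys IH] c /=.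
  by rewrite (big_pred1 [tuple]) /= ?mulr1 // => s; apply/esym/eqP; exact: tuple0.
rewrite (reindex (fun q : 'I_k * (size ys).-tuple 'I_k => [tuple of q.1 :: q.2])) /=.
  rewrite -(pair_bigA _ (fun (i : 'I_k) (s : (size ys).-tuple 'I_k) =>
    c (nat_of_ord i :: map (@nat_of_ord k) s) *
    (y v ^+ i * monomial ys (map (@nat_of_ord k) s) v))) /=.
  apply: eq_bigr => i _; rewrite IH mulr_sumr.
  by apply: eq_bigr => s _; rewrite mulrCA.
exists (fun s => (thead s, [tuple of behead s])) => [[i s] _|s _] /=.
  by congr (_, _); apply: val_inj.
by rewrite -tuple_eta.
Qed.

Lemma box_degree_monomial_value e K (ys : seq (affine -> F)) (s : seq nat) :
  (forall i, box_degree_le e (nth (fun=> 0) ys i)) -> all (fun i => i <= K)%N s ->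
  box_degree_le (size ys * (K * e)) (monomial ys s).
Proof.
elim: ys s => [|y ys IH] [|i s] ye /=; try by move=> _; exact: box_degree_const.
move=> /andP[iK sK]; rewrite mulSn; apply: box_degreeM.
  by apply: box_degreeW (box_degreeX i (ye 0%N)); rewrite leq_mul2r iK orbT.
by apply: IH => // j; exact: (ye j.+1).
Qed.

(** There are (K+1)^(size ys) monomials of degree at most K in each of the
    functions [ys], all in a space of dimension of order K^n. *)
Lemma alg_independent_affine (ys : seq (affine -> F)) :
  (forall i, polyfun (@aff_coord F n) (nth (fun=> 0) ys i)) ->
  alg_independent setT ys -> (size ys <= n)%N.
Proof.
move=> Pys indep; rewrite leqNgt; apply/negP => nd.
have [e ye] := polyfuns_box_degree Pys.
pose d := size ys; pose K := ((d * e).+1 ^ n)%N; pose E := (d * (K * e))%N.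
pose I : finType := d.-tuple 'I_K.+1; pose J : finType := {ffun 'I_n -> 'I_E.+1}.
(* E + 1 is at most (K + 1)(de + 1), and (de + 1)^n = K < K + 1. *)
have ltJI : (#|J| < #|I|)%N.
  rewrite card_tuple card_ffun !card_ord.
  apply: (@leq_trans (K.+1 ^ n.+1)); last exact: leq_pexp2l.
  apply: (@leq_ltn_trans ((K.+1 * (d * e).+1) ^ n)).
    by case: (n) => // n'; rewrite leq_exp2r // /E; nia.
  by rewrite expnMn -/K expnSr ltn_mul2l expn_gt0 /= ltnSn.
have /choice[M monE] : forall s : I, exists c : J -> F, forall u,
    monomial ys (map (@nat_of_ord K.+1) s) u = \sum_al c al * box_monomial al u.
  move=> s; apply: box_degree_monomial_value => //.
  by apply/allP => _ /mapP[i _ ->]; rewrite -ltnS ltn_ord.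
(* A row vector killed by the matrix of coefficients of the monomials in ys is a
   linear relation between these monomials. *)
pose A := \matrix_(i < #|I|, j < #|J|) M (enum_val i) (enum_val j).
have kerA : kermx A != 0.
  rewrite -mxrank_eq0 mxrank_ker subn_eq0 -ltnNge.
  exact: leq_ltn_trans (rank_leq_col A) ltJI.
have [x xA x0] : exists2 x : 'rV[F]_#|I|, x *m A = 0 & x != 0.
  exists (nz_row (kermx A)); last by rewrite nz_row_eq0.
  by apply/sub_kermxP; exact: nz_row_sub.
pose c (s : seq nat) :=
  \sum_(i < #|I| | map (@nat_of_ord K.+1) (enum_val i) == s) x 0 i.
have cE (i : 'I_#|I|) : c (map (@nat_of_ord K.+1) (enum_val i)) = x 0 i.
  rewrite /c (big_pred1 i) // => j /=.
  by rewrite (inj_eq (inj_map (@ord_inj _))) (inj_eq val_inj) (inj_eq enum_val_inj).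
move/eqP: x0; apply; apply/rowP => i; rewrite mxE -cE.
apply: (indep K.+1); first last.
- by apply/allP => _ /mapP[j _ ->]; rewrite ltn_ord.
- by rewrite size_map size_tuple.
move=> u _; rewrite poly_valueE (reindex (@enum_val I predT)) /=; last first.
  by apply: onW_bij; exact: enum_val_bij.
under eq_bigr => j _ do rewrite cE monE mulr_sumr.
rewrite exchange_big big1 // => al _.
have /rowP/(_ (enum_rank al)) := xA; rewrite !mxE => xAal.
under eq_bigr => j _ do rewrite mulrA.
rewrite -mulr_suml (_ : \sum_(_ < _) _ = 0) ?mul0r // -[RHS]xAal.
by apply: eq_bigr => j _; rewrite mxE enum_rankK.
Qed.

End Counting.

Lemma poly_value_comp (T T' : Type) k (ys : seq (T -> F)) c (phi : T' -> T) v :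
  poly_value k (map (fun y => y \o phi) ys) c v = poly_value k ys c (phi v).
Proof. by elim: ys c => [//|y ys IH] c /=; apply: eq_bigr => i _; rewrite IH. Qed.

(** Functions that are independent on [Z] remain so after composition with [phi],
    because the image of [phi] is dense. *)
Lemma dominates_chain_le N n (phi : (nat -> F) -> 'rV[F]_N) Z m :
  dominates n phi Z -> irreducible_chain Z m -> (m <= n)%N.
Proof.
move=> [Pphi Zphi dense] [C [Cirr Clt]].
have [i im|//|ys [szys Pys indep]] := @chain_alg_independent N m C.
  by have [? ? _] := Cirr i im.
have {}indep : alg_independent Z ys.
  by refine (alg_independentS _ indep); case: (Cirr m (leqnn _)).
have Pys' i : polyfun (@aff_coord F n) (nth (fun=> 0) (map (fun y => y \o phi) ys) i).
  have [iys|iys] := ltnP i (size ys); last first.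
    by rewrite nth_default ?size_map //; exact: polyfun_const.
  by rewrite (nth_map (fun=> 0)) //; exact: (polyfun_comp Pphi (Pys i)).
rewrite -szys -(size_map (fun y => y \o phi)).
refine (alg_independent_affine Pys' _).
move=> k c c0 s; rewrite size_map; apply: indep.
apply: dense; first exact: polyfun_poly_value.
by move=> u; rewrite -poly_value_comp c0.
Qed.

End Independence.

(** * Two by two matrices *)

Section Mx2.
Local Open Scope ring_scope.
Variable F : fieldType.
Implicit Types A B M : 'M[F]_2.

Definition mx2 (a b c d : F) : 'M[F]_2 :=
  \matrix_(i, j) (if i == 0 then if j == 0 then a else b
                  else if j == 0 then c else d).

Lemma mx2P A : A = mx2 (A 0 0) (A 0 1) (A 1 0) (A 1 1).
Proof. by apply/matrixP; elim/ord2_ind; elim/ord2_ind; rewrite !mxE. Qed.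

Lemma mx2_inj a b c d a' b' c' d' :
  mx2 a b c d = mx2 a' b' c' d' -> [/\ a = a', b = b', c = c' & d = d'].
Proof.
move=> /matrixP E; have := (E 0 0, E 0 1, E 1 0, E 1 1).
by rewrite !mxE /= => -[[[-> ->] ->] ->].
Qed.

Lemma sum_ord2 (f : 'I_2 -> F) : \sum_i f i = f 0 + f 1.
Proof.
rewrite !big_ord_recl big_ord0 addr0; congr (f _ + f _); exact: val_inj.
Qed.

Lemma mul_mx2 a b c d a' b' c' d' : mx2 a b c d *m mx2 a' b' c' d' =
  mx2 (a * a' + b * c') (a * b' + b * d') (c * a' + d * c') (c * b' + d * d').
Proof. by apply/matrixP; elim/ord2_ind; elim/ord2_ind; rewrite !mxE sum_ord2 !mxE. Qed.

Lemma add_mx2 a b c d a' b' c' d' : mx2 a b c d + mx2 a' b' c' d' =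
  mx2 (a + a') (b + b') (c + c') (d + d').
Proof. by apply/matrixP; elim/ord2_ind; elim/ord2_ind; rewrite !mxE. Qed.

Lemma scale_mx2 x a b c d : x *: mx2 a b c d = mx2 (x * a) (x * b) (x * c) (x * d).
Proof. by apply/matrixP; elim/ord2_ind; elim/ord2_ind; rewrite !mxE. Qed.

Lemma scalar_mx2 x : x%:M = mx2 x 0 0 x.
Proof. by apply/matrixP; elim/ord2_ind; elim/ord2_ind; rewrite !mxE. Qed.

Lemma tr_mx2 a b c d : \tr (mx2 a b c d) = a + d.
Proof. by rewrite /mxtrace sum_ord2 !mxE. Qed.

Lemma det_mx2E a b c d : \det (mx2 a b c d) = a * d - b * c.
Proof.
rewrite (expand_det_row _ 0) sum_ord2 /cofactor !det_mx11 !mxE /=.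
by rewrite expr0 mul1r expr1; ring.
Qed.

Lemma cayley_hamilton_SL2 A : \det A = 1 -> A *m A = \tr A *: A - 1%:M.
Proof.
rewrite (mx2P A); move: (A 0 0) (A 0 1) (A 1 0) (A 1 1) => a b c d.
rewrite det_mx2E tr_mx2 mul_mx2 scale_mx2 -scaleN1r scalar_mx2 scale_mx2 add_mx2 => D.
by congr mx2; rewrite ?mulr0 ?mulN1r -?D; ring.
Qed.

(** The commutant of a nonscalar matrix [M] is spanned by [M] and the identity,
    hence is commutative. *)
Lemma commutant_nonscalar M A : (forall c, M <> c%:M) -> A *m M = M *m A ->
  exists x y, A = x *: M + y%:M.
Proof.
rewrite (mx2P M) (mx2P A); move: (M 0 0) (M 0 1) (M 1 0) (M 1 1) => a b c d.
move: (A 0 0) (A 0 1) (A 1 0) (A 1 1) => e f g h Mns.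
rewrite !mul_mx2 => /mx2_inj[E1 E2 E3 E4].
have F1 : f * c = b * g by apply: (addrI (e * a)); rewrite E1; ring.
have F2 : b * (e - h) = f * (a - d).
  by apply/eqP; rewrite -subr_eq0 (_ : _ - _ = (e * b + f * d) - (a * f + b * h));
    [rewrite E2 subrr|ring].
have F3 : c * (e - h) = g * (a - d).
  by apply/eqP; rewrite -subr_eq0 (_ : _ - _ = (c * e + d * g) - (g * a + h * c));
    [rewrite E3 subrr|ring].
have build x : f = x * b -> g = x * c -> e - h = x * (a - d) ->
    exists x y, mx2 e f g h = x *: mx2 a b c d + y%:M.
  move=> fE gE eE; exists x, (e - x * a).
  rewrite scale_mx2 scalar_mx2 add_mx2; congr mx2; rewrite ?addr0 //; first ring.
  have -> : h = e - (e - h) by ring.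
  by rewrite eE; ring.
have [b0|b0] := eqVneq b 0; last first.
  apply: (build (f / b)); first by rewrite divfK.
    by apply: (mulfI b0); rewrite -F1; field.
  by apply: (mulfI b0); rewrite F2; field.
have [c0|c0] := eqVneq c 0; last first.
  apply: (build (g / c)); last by apply: (mulfI c0); rewrite F3; field.
    by apply: (mulIf c0); rewrite F1; field.
  by rewrite divfK.
have ad : a - d != 0.
  apply/eqP => /eqP; rewrite subr_eq0 => /eqP ad.
  by apply: (Mns a); rewrite scalar_mx2 b0 c0 ad.
apply: (build ((e - h) / (a - d))); last by rewrite divfK.
- move/eqP: F2; rewrite b0 mul0r eq_sym mulf_eq0 (negPf ad) orbF => /eqP ->.
  by rewrite mulr0.
- move/eqP: F3; rewrite c0 mul0r eq_sym mulf_eq0 (negPf ad) orbF => /eqP ->.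
  by rewrite mulr0.
Qed.

Lemma commute_commutant M A B : (forall c, M <> c%:M) ->
  A *m M = M *m A -> B *m M = M *m B -> A *m B = B *m A.
Proof.
move=> Mns /(commutant_nonscalar Mns)[x [y ->]] /(commutant_nonscalar Mns)[x' [y' ->]].
rewrite (mx2P M) !scale_mx2 !scalar_mx2 !add_mx2 !mul_mx2.
by congr mx2; ring.
Qed.

Lemma det_expr A k : \det (A ^+ k) = \det A ^+ k.
Proof. by elim: k => [|k IH]; rewrite ?expr0 ?det1 // !exprS det_mulmx IH. Qed.

End Mx2.

Section SL2.
Local Open Scope ring_scope.
Variable F : numClosedFieldType.
Implicit Types A B : 'M[F]_2.

Lemma prim_root_exists n : (0 < n)%N -> exists w : F, n.-primitive_root w.
Proof.
move=> n_gt0; have [r rE] := closed_field_poly_normal ('X^n - 1 : {poly F}).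
rewrite (monicP (monicXnsubC 1 n_gt0)) scale1r in rE.
have [|||w _ wP] := hasP (@cyclic.has_prim_root F n r n_gt0 _ _ _); last by exists w.
- by apply/allP => z; rewrite -root_prod_XsubC -rE.
- rewrite -separable.separable_prod_XsubC -rE.
  by rewrite cyclotomic.separable_Xn_sub_1 // pnatr_eq0 -lt0n.
- by rewrite -ltnS -(size_prod_XsubC r id) -rE size_XnsubC.
Qed.

(** The Cayley-Hamilton reduction of A^2 drives the recursions for A^n below. *)
Lemma SL2_affine_mul A x y : \det A = 1 ->
  (x *: A - y%:M) *m A = (x * \tr A - y) *: A - x%:M.
Proof.
move=> dA; rewrite mulmxBl -scalemxAl cayley_hamilton_SL2 // mul_scalar_mx.
by rewrite scalerBr scalerA scalemx1 scalerBl addrAC.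
Qed.

(** A closed formula for A^n, up to the factor lam - mu. *)
Lemma SL2_expr_distinct A lam mu n : lam * mu = 1 -> \det A = 1 -> \tr A = lam + mu ->
  (lam - mu) *: (A ^+ n) = (lam ^+ n - mu ^+ n) *: A - (lam ^+ n * mu - mu ^+ n * lam)%:M.
Proof.
move=> lm dA tA; elim: n => [|n IH].
  by rewrite !expr0 subrr scale0r sub0r !mul1r -raddfN opprB -[1 in LHS]/(1%:M) scale_scalar_mx mulr1.
rewrite exprSr -mulmxE scalemxAl IH SL2_affine_mul // tA !exprSr.
rewrite -!mulrA [mu * lam]mulrC lm !mulr1; congr (_ *: A - _); ring.
Qed.

(** The previous formula is void when the eigenvalues coincide, being then both 1
    or both -1; this one replaces it. *)
Lemma SL2_expr_double A lam n : lam * lam = 1 -> \det A = 1 -> \tr A = lam + lam ->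
  lam *: (A ^+ n) = (n%:R * lam ^+ n) *: A - (lam ^+ n * lam * (n%:R - 1))%:M.
Proof.
move=> ll dA tA; elim: n => [|n IH].
  by rewrite !expr0 mul0r scale0r sub0r sub0r mul1r mulrN1 -raddfN opprK -[1 in LHS]/(1%:M) scale_scalar_mx mulr1.
rewrite exprSr -mulmxE scalemxAl IH SL2_affine_mul // tA.
rewrite exprSr -(mulrA _ lam lam) ll mulr1 -natr1.
by congr (_ *: A - _%:M); ring.
Qed.

Lemma scalar_mx2_inj (x y : F) : (x%:M : 'M[F]_2) = y%:M -> x = y.
Proof. by move/matrixP/(_ 0 0); rewrite !mxE. Qed.

(** Comparing coefficients in a relation between a nonscalar matrix and 1. *)
Lemma scale_mx_scalar A x y : x *: A = y%:M -> (forall c, A <> c%:M) ->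
  x = 0.
Proof.
move=> xA Ans; apply: contrapT => /eqP x0; apply: (Ans (x^-1 * y)).
by rewrite -scale_scalar_mx -xA scalerA mulVf // scale1r.
Qed.

(** If a power of a nonscalar matrix is scalar, its two eigenvalues differ, since
    a nontrivial Jordan block has no scalar power. *)
Lemma SL2_scalar_power A n c : (0 < n)%N -> \det A = 1 -> (forall c, A <> c%:M) ->
  A ^+ n = c%:M ->
  exists lam, [/\ lam != 0, lam != lam^-1, \tr A = lam + lam^-1 & lam ^+ n = c].
Proof.
move=> n_gt0 dA Ans Anc.
pose del := sqrtC (\tr A ^+ 2 - 4); pose lam := (\tr A + del) / 2; pose mu := (\tr A - del) / 2.
have tA : \tr A = lam + mu by rewrite /lam /mu; field.
have lm : lam * mu = 1.
  rewrite /lam /mu (_ : _ * _ = (\tr A ^+ 2 - del ^+ 2) / 4); last by field.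
  by rewrite sqrtCK; field.
have lam0 : lam != 0 by apply/eqP => l0; move/eqP: lm; rewrite l0 mul0r eq_sym oner_eq0.
have muE : mu = lam^-1 by apply: (mulfI lam0); rewrite lm divff.
have lmu : lam != mu.
  apply/eqP => lmu; rewrite -lmu in lm tA.
  have := SL2_expr_double n lm dA tA; rewrite Anc scale_scalar_mx => /eqP.
  rewrite eq_sym subr_eq -raddfD => /eqP/scale_mx_scalar-/(_ Ans)/eqP; apply/negP.
  by rewrite mulf_neq0 ?expf_neq0 // pnatr_eq0 -lt0n.
exists lam; rewrite -muE; split=> //.
have := SL2_expr_distinct n lm dA tA; rewrite Anc scale_scalar_mx => /eqP.
rewrite eq_sym subr_eq -raddfD => /eqP E.
have /eqP := scale_mx_scalar E Ans; rewrite subr_eq0 => /eqP lnmn.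
move: E; rewrite lnmn subrr scale0r => /esym; rewrite -[0 in RHS](raddf0 (@scalar_mx F 2)).
move=> /scalar_mx2_inj E; apply: (mulfI (_ : lam - mu != 0)); first by rewrite subr_eq0.
by apply/eqP; rewrite -subr_eq0 -[X in _ == X]oppr0 -E -lnmn; apply/eqP; ring.
Qed.

End SL2.

(** * Pairs of matrices as points of affine space *)

Section Points.
Local Open Scope ring_scope.
Variable F : numClosedFieldType.
Local Notation point := 'rV[F]_(2 * (2 * 2)).

Definition pair_point (A B : 'M[F]_2) : point :=
  mxvec (\matrix_(i < 2) mxvec (if i == 0 then A else B)).

Definition point_mx (i : 'I_2) (v : point) : 'M[F]_2 := vec_mx (row i (vec_mx v)).

Lemma point_mxE i (v : point) j k :
  point_mx i v j k = v ord0 (mxvec_index i (mxvec_index j k)).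
Proof. by rewrite !mxE. Qed.

Lemma point_mx_pair0 A B : point_mx 0 (pair_point A B) = A.
Proof. by rewrite /point_mx mxvecK rowK mxvecK. Qed.

Lemma point_mx_pair1 A B : point_mx 1 (pair_point A B) = B.
Proof. by rewrite /point_mx mxvecK rowK mxvecK. Qed.

Lemma pair_point_mx v : pair_point (point_mx 0 v) (point_mx 1 v) = v.
Proof.
apply: (can_inj vec_mxK); rewrite mxvecK; apply/row_matrixP => i.
rewrite rowK; apply: (can_inj vec_mxK); rewrite mxvecK.
by elim/ord2_ind: i.
Qed.

Definition polymx (T I : Type) (X : I -> T -> F) (A : T -> 'M[F]_2) : Prop :=
  forall j k, polyfun X (fun v => A v j k).

Section PolyMx.
Variables (T I : Type) (X : I -> T -> F).

Lemma polymx2 a b c d : polyfun X a -> polyfun X b -> polyfun X c -> polyfun X d ->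
  polymx X (fun v => mx2 (a v) (b v) (c v) (d v)).
Proof.
move=> Xa Xb Xc Xd; elim/ord2_ind; elim/ord2_ind;
  [move: Xa|move: Xb|move: Xc|move: Xd]; apply: polyfun_ext => v; by rewrite mxE.
Qed.

Lemma polymx_const A : polymx X (fun=> A).
Proof. by move=> j k; exact: polyfun_const. Qed.

Lemma polymxM A B : polymx X A -> polymx X B -> polymx X (fun v => A v *m B v).
Proof.
move=> XA XB j k; apply: (polyfun_ext (f := fun v => \sum_i A v j i * B v i k)).
  by move=> v; rewrite mxE.
by apply: polyfun_sum => i; exact: polyfunM.
Qed.

Lemma polymxX A n : polymx X A -> polymx X (fun v => A v ^+ n).
Proof.
move=> XA; elim: n => [|n IH]; first exact: polymx_const.
move=> j k; apply: polyfun_ext (polymxM XA IH j k) => v.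
by rewrite exprS mulmxE.
Qed.

Lemma polyfun_det A : polymx X A -> polyfun X (fun v => \det (A v)).
Proof.
move=> XA; apply: (polyfun_ext
    (f := fun v => A v 0 0 * A v 1 1 - A v 0 1 * A v 1 0)) => [v|].
  by rewrite [in RHS](mx2P (A v)) det_mx2E.
by apply: polyfunB; exact: polyfunM.
Qed.

Lemma polyfun_tr A : polymx X A -> polyfun X (fun v => \tr (A v)).
Proof. by move=> XA; apply: polyfun_sum => i; exact: XA. Qed.

Lemma polyfun_pair_point A B : polymx X A -> polymx X B ->
  forall i, polyfun X (fun v => pair_point (A v) (B v) ord0 i).
Proof.
move=> XA XB i; case/mxvec_indexP: i => i jk; case/mxvec_indexP: jk => j k.
elim/ord2_ind: i; [move: (XA j k)|move: (XB j k)]; apply: polyfun_ext => v;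
  by rewrite -point_mxE ?point_mx_pair0 ?point_mx_pair1.
Qed.

End PolyMx.

Lemma polymx_point_mx i : polymx (@row_coord F _) (point_mx i).
Proof.
move=> j k; apply: (polyfun_ext (f := row_coord (mxvec_index i (mxvec_index j k)))).
  by move=> v; rewrite point_mxE.
exact: polyfun_coord.
Qed.

Lemma zariski_closed_mx_eq (A B : point -> 'M[F]_2) :
  polymx (@row_coord F _) A -> polymx (@row_coord F _) B ->
  zariski_closed [set v | A v = B v].
Proof.
move=> PA PB; rewrite (_ : mkset _ = [set v | forall j k, A v j k = B v j k]).
  apply: zariski_closed_forall => j; apply: zariski_closed_forall => k.
  exact: zariski_closed_eq.
by apply/seteqP; split => v /= => [->|E] //; apply/matrixP.
Qed.

End Points.

(** * Four-dimensional components *)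

Section ConjugacyClasses.
Local Open Scope ring_scope.
Variable F : numClosedFieldType.
Implicit Types (A B : 'M[F]_2) (S : set 'M[F]_2).

(** The two-parameter family [cell] covers [S] generically, as witnessed by
    polynomial curves (compare [dominates_curves]). *)
Definition covers_generically (cell : F -> F -> 'M[F]_2) S : Prop :=
  [/\ forall (f g : (nat -> F) -> F), polyfun (@aff_coord F 4) f ->
        polyfun (@aff_coord F 4) g -> polymx (@aff_coord F 4) (fun u => cell (f u) (g u)),
      forall x y, S (cell x y)
    & forall A, S A -> exists (gam : F -> 'M[F]_2) (q : F -> F),
        [/\ polymx (@line_coord F) gam, gam 0 = A, polyfun (@line_coord F) q,
            exists s, q s <> 0
          & forall s, q s <> 0 -> exists x y, gam s = cell x y]].

Lemma covers_generically_dominates cA SA cB SB :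
  covers_generically cA SA -> covers_generically cB SB ->
  dominates 4 (fun u => pair_point (cA (u 0%N) (u 1%N)) (cB (u 2%N) (u 3%N)))
    [set v | SA (point_mx 0 v) /\ SB (point_mx 1 v)].
Proof.
move=> [PA cSA curveA] [PB cSB curveB].
have coord (i : nat) : (i < 4)%N -> polyfun (@aff_coord F 4) (fun u => u i).
  by move=> i4; exact: (polyfun_coord _ (Ordinal i4)).
apply: dominates_curves => [|u|v /= [/curveA[gA [qA [PgA gA0 PqA [sA qsA] gqA]]]
    /curveB[gB [qB [PgB gB0 PqB [sB qsB] gqB]]]]].
- by apply: polyfun_pair_point; [apply: PA|apply: PB]; exact: coord.
- by rewrite /= point_mx_pair0 point_mx_pair1.
exists (fun s => pair_point (gA s) (gB s)), (fun s => qA s * qB s); split.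
- exact: polyfun_pair_point.
- by rewrite gA0 gB0 pair_point_mx.
- exact: polyfunM.
- apply: contrapT => /forallNP q0.
  have qq s : qA s * qB s = 0 by exact: contrapT (q0 s).
  by have [/(_ sA)|/(_ sB)] := polyfun_line_domain PqA PqB qq.
- move=> s qs; have /gqA[x [y ->]] : qA s <> 0 by move=> q0; rewrite q0 mul0r in qs.
  have /gqB[x' [y' ->]] : qB s <> 0 by move=> q0; rewrite q0 mulr0 in qs.
  by exists (nth 0 [:: x; y; x'; y']).
Qed.

Section Class.
Variable lam : F.
Hypotheses (lam0 : lam != 0) (lamV : lam != lam^-1).

Definition conj_class : set 'M[F]_2 :=
  [set A | \det A = 1 /\ \tr A = lam + lam^-1].
Definition conj_class_line : set 'M[F]_2 := [set A | exists x, A = mx2 lam x 0 lam^-1].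
Definition conj_class_pt : set 'M[F]_2 := [set mx2 lam 0 0 lam^-1].

(** The conjugate of diag(lam, 1/lam) by the product of an upper and a lower
    unipotent matrix, up to rescaling one parameter. *)
Definition class_cell (x y : F) : 'M[F]_2 :=
  mx2 (lam + x * y) (x * (lam^-1 - lam - x * y)) y (lam^-1 - x * y).

Let const_curve (cell : F -> F -> 'M[F]_2) A x y : A = cell x y ->
  exists (gam : F -> 'M[F]_2) (q : F -> F),
    [/\ polymx (@line_coord F) gam, gam 0 = A, polyfun (@line_coord F) q,
        exists s, q s <> 0
      & forall s, q s <> 0 -> exists x y, gam s = cell x y].
Proof.
move=> ->; exists (fun=> cell x y), (fun=> 1); split=> //.
- exact: polymx_const.
- exact: polyfun_const.
- by exists 0; exact/eqP/oner_neq0.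
- by move=> _ _; exists x, y.
Qed.

Lemma covers_pt : covers_generically (fun _ _ => mx2 lam 0 0 lam^-1) conj_class_pt.
Proof.
split=> // [f g _ _|A ->]; first exact: polymx_const.
exact: (const_curve (x := 0) (y := 0)).
Qed.

Lemma covers_line : covers_generically (fun x _ => mx2 lam x 0 lam^-1) conj_class_line.
Proof.
split=> [f g Pf _|x _|A [x ->]]; last exact: (const_curve (x := x) (y := 0)).
  by apply: polymx2 => //; exact: polyfun_const.
by exists x.
Qed.

Lemma class_cellP A : conj_class A -> A 1 0 <> 0 -> exists x y, A = class_cell x y.
Proof.
rewrite [A](mx2P A); move: (A 0 0) (A 0 1) (A 1 0) (A 1 1) => a b c d.
rewrite /conj_class /= det_mx2E tr_mx2 => -[D T]; rewrite mxE /= => /eqP c0.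
exists ((a - lam) / c), c; rewrite /class_cell divfK //.
have dE : d = lam^-1 - (a - lam) by rewrite -[LHS](addKr a) T; ring.
congr mx2; [by rewrite addrC subrK| |by []].
apply: (mulfI c0); rewrite mulrCA mulrA divfK // (_ : lam^-1 - lam - (a - lam) = lam^-1 - a); last by ring.
rewrite mulrC (_ : b * c = a * d - 1); last by rewrite -D; ring.
rewrite dE; apply/eqP; rewrite -subr_eq0.
rewrite (_ : _ - _ = lam * lam^-1 - 1); last by ring.
by rewrite divff // subrr.
Qed.

(** The points outside the cell are those with lower left entry 0; conjugating
    by lower unipotent matrices moves them into the cell, since no element of the
    class is scalar. *)
Lemma covers_class : covers_generically class_cell conj_class.
Proof.
split.
- move=> f g Pf Pg; have Pfg := polyfunM Pf Pg.
  have Pcst c : polyfun (@aff_coord F 4) (fun=> c) by exact: polyfun_const.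
  apply: polymx2 => //; first exact: polyfunD.
    by apply: polyfunM => //; apply: polyfunB => //; exact: Pcst.
  exact: polyfunB.
- move=> x y; rewrite /conj_class /class_cell /= det_mx2E tr_mx2.
  split; last by ring.
  by rewrite -[RHS](divff lam0); ring.
move=> A clA; move: (clA); rewrite [A](mx2P A).
move: (A 0 0) (A 0 1) (A 1 0) (A 1 1) => a b c d.
rewrite /conj_class /= det_mx2E tr_mx2 => -[D T].
pose gam s := mx2 (a - s * b) b (c + s * (a - d) - s * s * b) (d + s * b).
have Ps : polyfun (@line_coord F) (fun s => s) by exact: (polyfun_coord _ tt).
have Pcst x : polyfun (@line_coord F) (fun=> x) by exact: polyfun_const.
have Pq : polyfun (@line_coord F) (fun s => c + s * (a - d) - s * s * b).
  apply: polyfunB; last by do 2?apply: polyfunM.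
  by apply: polyfunD => //; exact: polyfunM.
exists gam, (fun s => c + s * (a - d) - s * s * b); split=> //.
- apply: polymx2 => //; first by apply: polyfunB => //; exact: polyfunM.
  by apply: polyfunD => //; exact: polyfunM.
- by rewrite /gam; congr mx2; ring.
- apply: contrapT => /forallNP q0.
  have {}q0 s : c + s * (a - d) - s * s * b = 0 by exact: contrapT (q0 s).
  have c0 : c = 0 by rewrite -[RHS](q0 0); ring.
  have b0 : b = 0.
    apply: (mulfI (_ : - 2%:R != 0)); first by rewrite oppr_eq0 pnatr_eq0.
    rewrite (_ : _ * b = (c + 1 * (a - d) - 1 * 1 * b) + (c + -1 * (a - d) - -1 * -1 * b) - 2 * c).
      by rewrite !q0 c0 mulr0 addr0 subr0 mulr0.
    by ring.
  have ad : a = d.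
    by apply/eqP; rewrite -subr_eq0 -(q0 1) c0 b0; apply/eqP; ring.
  move/eqP: lamV; apply; apply/eqP; rewrite -subr_eq0 -sqrf_eq0.
  rewrite (_ : _ ^+ 2 = (lam + lam^-1) ^+ 2 - 4 * (lam * lam^-1)); last by ring.
  rewrite -T (_ : lam * lam^-1 = a * d - b * c); last by rewrite divff.
  by rewrite c0 b0 ad; apply/eqP; ring.
move=> s qs; apply: class_cellP; last by rewrite mxE.
rewrite /conj_class /= det_mx2E tr_mx2 -D -T; split; ring.
Qed.

End Class.

Section Component.
Variables lam nu : F.
Hypotheses (lam0 : lam != 0) (lamV : lam != lam^-1) (nu0 : nu != 0) (nuV : nu != nu^-1).

Definition class_pair : set 'rV[F]_(2 * (2 * 2)) :=
  [set v | conj_class lam (point_mx 0 v) /\ conj_class nu (point_mx 1 v)].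

Let closed_class l i : zariski_closed [set v | conj_class l (@point_mx F i v)].
Proof.
apply: zariski_closedI; apply: zariski_closed_eq; try exact: polyfun_const.
  by apply: polyfun_det; exact: polymx_point_mx.
by apply: polyfun_tr; exact: polymx_point_mx.
Qed.

Let closed_line l i : zariski_closed [set v | conj_class_line l (@point_mx F i v)].
Proof.
rewrite (_ : mkset _ = [set v | point_mx i v 0 0 = l] `&`
    ([set v | point_mx i v 1 0 = 0] `&` [set v | point_mx i v 1 1 = l^-1])).
  do 2?apply: zariski_closedI; apply: zariski_closed_eq; try exact: polyfun_const;
    exact: polymx_point_mx.
apply/seteqP; split => v /= => [[x ->]|[e00 [e10 e11]]]; first by rewrite !mxE.
by exists (point_mx i v 0 1); rewrite [LHS]mx2P e00 e10 e11.
Qed.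

Let closed_pt l i : zariski_closed [set v | conj_class_pt l (@point_mx F i v)].
Proof.
by apply: zariski_closed_mx_eq; [exact: polymx_point_mx|exact: polymx_const].
Qed.

Lemma zariski_closed_class_pair : zariski_closed class_pair.
Proof. by apply: zariski_closedI; exact: closed_class. Qed.

Lemma class_pair_irreducible : zariski_irreducible class_pair.
Proof.
exact: dominates_irreducible
  (covers_generically_dominates (covers_class lam0 lamV) (covers_class nu0 nuV)).
Qed.

Let pt_line l : conj_class_pt l `<` conj_class_line l.
Proof.
split; first by move=> _ ->; exists 0.
move=> /(_ (mx2 l 1 0 l^-1)) H; have /mx2_inj[_ /eqP] : conj_class_pt l (mx2 l 1 0 l^-1).
  by apply: H; exists 1.
by rewrite oner_eq0.
Qed.

Let line_class l : l != 0 -> conj_class_line l `<` conj_class l.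
Proof.
move=> l0; split.
  move=> _ [x ->]; rewrite /conj_class /= det_mx2E tr_mx2 mulr0 subr0.
  by rewrite divff.
move=> /(_ (mx2 l 0 1 l^-1)) H.
have [x /mx2_inj[_ _ /eqP]] : conj_class_line l (mx2 l 0 1 l^-1).
  by apply: H; rewrite /conj_class /= det_mx2E tr_mx2 mul0r subr0 divff.
by rewrite oner_eq0.
Qed.

(** The chain of length 4 is point x point, line x point, class x point,
    class x line, class x class, where the point is the diagonal matrix of the
    class and the line consists of the upper triangular matrices with the same
    diagonal. *)
Lemma krull_dim_class_pair : krull_dim class_pair 4.
Proof.
split; last first.
  move=> m; apply: dominates_chain_le.
  exact: covers_generically_dominates (covers_class lam0 lamV) (covers_class nu0 nuV).
pose SA := [:: conj_class_pt lam; conj_class_line lam; conj_class lam; conj_class lam; conj_class lam].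
pose SB := [:: conj_class_pt nu; conj_class_pt nu; conj_class_pt nu; conj_class_line nu; conj_class nu].
exists (fun i => [set v | nth set0 SA i (point_mx 0 v) /\ nth set0 SB i (point_mx 1 v)]).
have [lA _] := line_class lam0; have [pA _] := pt_line lam.
have [lB _] := line_class nu0; have [pB _] := pt_line nu.
have prod_lt (SA1 SA2 SB1 SB2 : set 'M[F]_2) : SA1 `<=` SA2 -> SB1 `<=` SB2 ->
    SA1 !=set0 -> SB1 !=set0 -> SA1 `<` SA2 \/ SB1 `<` SB2 ->
    [set v : 'rV[F]_(2 * (2 * 2)) | SA1 (point_mx 0 v) /\ SB1 (point_mx 1 v)] `<`
    [set v | SA2 (point_mx 0 v) /\ SB2 (point_mx 1 v)].
  move=> sA sB [A SA1A] [B SB1B] lt; split; first by move=> v [/sA ? /sB].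
  move=> H; case: lt => -[s ns]; apply: ns => C SC.
    have [|sC _] := H (pair_point C B); last by rewrite point_mx_pair0 in sC.
    by rewrite /= point_mx_pair0 point_mx_pair1; split=> //; exact: sB.
  have [|_ sC] := H (pair_point A C); last by rewrite point_mx_pair1 in sC.
  by rewrite /= point_mx_pair0 point_mx_pair1; split=> //; exact: sA.
have nept l : conj_class_pt l !=set0 by exists (mx2 l 0 0 l^-1).
have neline l : conj_class_line l !=set0 by exists (mx2 l 0 0 l^-1), 0.
have neclass l : l != 0 -> conj_class l !=set0.
  by move=> /line_class[lc _]; have [A /lc] := neline l; exists A.
have cp := covers_pt; have cl := covers_line.
have cA := covers_class lam0 lamV; have cB := covers_class nu0 nuV.
split=> [[|[|[|[|[|//]]]]] _|[|[|[|[|//]]]] _] /=.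
- split; [apply: zariski_closedI; [exact: closed_pt|exact: closed_pt]| |by move=> v [/pA/lA ? /pB/lB ?]; split].
  exact: dominates_irreducible (covers_generically_dominates (cp _) (cp _)).
- split; [apply: zariski_closedI; [exact: closed_line|exact: closed_pt]| |by move=> v [/lA ? /pB/lB ?]; split].
  exact: dominates_irreducible (covers_generically_dominates (cl _) (cp _)).
- split; [apply: zariski_closedI; [exact: closed_class|exact: closed_pt]| |by move=> v [? /pB/lB ?]; split].
  exact: dominates_irreducible (covers_generically_dominates cA (cp _)).
- split; [apply: zariski_closedI; [exact: closed_class|exact: closed_line]| |by move=> v [? /lB ?]; split].
  exact: dominates_irreducible (covers_generically_dominates cA (cl _)).
- split; [apply: zariski_closedI; [exact: closed_class|exact: closed_class]|exact: class_pair_irreducible|by []].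
- by apply: prod_lt => //; left.
- by apply: prod_lt => //; left; exact: line_class.
- by apply: prod_lt => //; [exact: neclass|right].
- by apply: prod_lt => //; [exact: neclass|right; exact: line_class].
Qed.

End Component.

End ConjugacyClasses.

(** * The variety of pairs with A^p = B^t *)

Section PairVariety.
Local Open Scope ring_scope.
Variable F : numClosedFieldType.
Local Notation point := 'rV[F]_(2 * (2 * 2)).
Implicit Types (A B : 'M[F]_2) (v : point).

Definition pair_variety (p t : nat) : set point :=
  [set v | [/\ \det (point_mx 0 v) = 1, \det (point_mx 1 v) = 1
             & point_mx 0 v ^+ p = point_mx 1 v ^+ t]].

Definition commuting_pairs (p t : nat) : set point :=
  pair_variety p t `&` [set v | point_mx 0 v *m point_mx 1 v = point_mx 1 v *m point_mx 0 v].

Lemma zariski_closed_commuting_pairs p t : zariski_closed (commuting_pairs p t).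
Proof.
have P i := @polymx_point_mx F i.
rewrite (_ : commuting_pairs p t = [set v | \det (point_mx 0 v) = 1] `&`
    ([set v | \det (point_mx 1 v) = 1] `&`
    ([set v | point_mx 0 v ^+ p = point_mx 1 v ^+ t] `&`
     [set v | point_mx 0 v *m point_mx 1 v = point_mx 1 v *m point_mx 0 v]))).
  do 3?apply: zariski_closedI.
  - by apply: zariski_closed_eq; [exact: polyfun_det|exact: polyfun_const].
  - by apply: zariski_closed_eq; [exact: polyfun_det|exact: polyfun_const].
  - by apply: zariski_closed_mx_eq; exact: polymxX.
  - by apply: zariski_closed_mx_eq; exact: polymxM.
by apply/seteqP; split => v [] => [[? ? ?] ?|? [? []]].
Qed.

(** A product of an upper, a lower and an upper unipotent matrix. *)
Definition SL2_cell (x y z : F) : 'M[F]_2 :=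
  mx2 (1 + x * y) (z * (1 + x * y) + x) y (1 + y * z).

Lemma det_SL2_cell x y z : \det (SL2_cell x y z) = 1.
Proof. by rewrite det_mx2E; ring. Qed.

Lemma SL2_cellP a b c d : a * d - b * c = 1 -> c <> 0 ->
  exists x y z, mx2 a b c d = SL2_cell x y z.
Proof.
move=> D /eqP c0; exists ((a - 1) / c), c, ((d - 1) / c).
have aE : 1 + (a - 1) / c * c = a by rewrite divfK // addrC subrK.
rewrite /SL2_cell aE; congr mx2; last first.
  by rewrite mulrCA divff // mulr1 addrC subrK.
apply: (mulIf c0); rewrite mulrDl mulrAC !divfK // (_ : b * c = a * d - 1).
  by ring.
by rewrite -D; ring.
Qed.

(** If ut = vp + 1, then c = A^u B^-v works; the inverse of B is its adjugate. *)
Lemma commuting_power_root p t A B : (0 < t)%N -> coprime p t -> \det A = 1 ->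
  \det B = 1 -> A ^+ p = B ^+ t -> A *m B = B *m A ->
  exists c : 'M[F]_2, [/\ \det c = 1, c ^+ t = A & c ^+ p = B].
Proof.
move=> t0 pt dA dB AB cAB.
have [u v E _] := egcdnP p t0; rewrite gcdnC (eqP pt) in E.
pose B' := \adj B.
have BB' : B * B' = 1 by rewrite -mulmxE mul_mx_adj dB.
have B'B : B' * B = 1 by rewrite -mulmxE mul_adj_mx dB.
have dB' : \det B' = 1.
  by rewrite -[LHS]mul1r -{1}dB -det_mulmx mulmxE BB' det1.
have cAB' : GRing.comm A B'.
  rewrite /GRing.comm -[A * B']mul1r -{1}B'B -!mulrA; congr (_ * _).
  by rewrite mulrA -(cAB : A * B = B * A) -mulrA BB' mulr1.
have BB'X n : B ^+ n * B' ^+ n = 1.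
  rewrite -exprMn_comm ?BB' ?expr1n //.
  by rewrite /GRing.comm BB' B'B.
exists (A ^+ u * B' ^+ v); split.
- by rewrite -mulmxE det_mulmx !det_expr dA dB' !expr1n mulr1.
- rewrite exprMn_comm; last by apply: commrX; apply/commr_sym/commrX/commr_sym.
  rewrite -!exprM E addn1 exprS mulnC exprM AB -exprM [(v * t)%N]mulnC.
  by rewrite -mulrA BB'X mulr1.
- rewrite exprMn_comm; last by apply: commrX; apply/commr_sym/commrX/commr_sym.
  rewrite -!exprM mulnC exprM AB -exprM mulnC E addn1 exprS -mulrA.
  by rewrite BB'X mulr1.
Qed.

(** A commuting pair is (c^t, c^p) for some c in SL2, and SL2 has three
    parameters. The matrices c outside the cell have lower left entry 0; multiplying
    them on the right by lower unipotent matrices moves them into the cell. *)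
Lemma commuting_pairs_dominated p t : (0 < t)%N -> coprime p t ->
  dominates 3 (fun u => pair_point (SL2_cell (u 0%N) (u 1%N) (u 2%N) ^+ t)
                                   (SL2_cell (u 0%N) (u 1%N) (u 2%N) ^+ p))
    (commuting_pairs p t).
Proof.
move=> t0 pt; apply: dominates_curves.
- have coord (i : nat) : (i < 3)%N -> polyfun (@aff_coord F 3) (fun u => u i).
    by move=> i3; exact: (polyfun_coord _ (Ordinal i3)).
  have [[P0 P1] P2] := (coord 0%N isT, coord 1%N isT, coord 2%N isT).
  have P01 := polyfunM P0 P1.
  have K1 : polyfun (@aff_coord F 3) (fun=> 1) by exact: polyfun_const.
  have PC : polymx (@aff_coord F 3) (fun u => SL2_cell (u 0%N) (u 1%N) (u 2%N)).
    apply: polymx2 => //; first exact: polyfunD.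
      by apply: polyfunD => //; apply: polyfunM => //; exact: polyfunD.
    by apply: polyfunD => //; exact: polyfunM.
  by apply: polyfun_pair_point; exact: polymxX.
- move=> u; split; rewrite /pair_variety /= point_mx_pair0 point_mx_pair1.
    by split; rewrite ?det_expr ?det_SL2_cell ?expr1n // -!exprM mulnC.
  by rewrite !mulmxE -!exprD addnC.
move=> v [[dA dB AB] cAB].
have [C [dC CA CB]] := commuting_power_root t0 pt dA dB AB cAB.
move: dC CA CB; rewrite [C](mx2P C).
move: (C 0 0) (C 0 1) (C 1 0) (C 1 1) => a b c d; rewrite det_mx2E => D CA CB.
pose gam s := mx2 (a + b * s) b (c + d * s) d.
have Ps : polyfun (@line_coord F) (fun s => s) by exact: (polyfun_coord _ tt).
have Pcst x : polyfun (@line_coord F) (fun=> x) by exact: polyfun_const.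
have Pq x y : polyfun (@line_coord F) (fun s => x + y * s).
  by apply: polyfunD => //; exact: polyfunM.
have Pgam : polymx (@line_coord F) gam by exact: polymx2.
exists (fun s => pair_point (gam s ^+ t) (gam s ^+ p)), (fun s => c + d * s); split=> //.
- by apply: polyfun_pair_point; exact: polymxX.
- by rewrite /gam !mulr0 !addr0 CA CB pair_point_mx.
- have [c0|/eqP c0] := eqVneq c 0; last by exists 0; rewrite mulr0 addr0.
  exists 1; rewrite c0 add0r mulr1 => d0.
  by move/eqP: D; rewrite c0 d0 !mulr0 subr0 eq_sym oner_eq0.
move=> s /(@SL2_cellP (a + b * s) b _ d)[|x [y [z E]]]; first by rewrite -D; ring.
by exists (nth 0 [:: x; y; z]); rewrite /gam E.
Qed.

Lemma prim_root_half n (u : F) : (0 < n)%N -> (2 * n)%N.-primitive_root u -> u ^+ n = -1.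
Proof.
move=> n_gt0 uP; have /eqP : (u ^+ n) ^+ 2 = 1.
  by rewrite -exprM mulnC prim_expr_order.
rewrite sqrf_eq1 => /orP[/eqP un|/eqP //].
have := prim_order_dvd uP n; rewrite un eqxx => /(dvdn_leq n_gt0).
by rewrite leqNgt -{1}[n]mul1n ltn_mul2r n_gt0.
Qed.

Lemma prim_root_neqV n (u : F) k : (2 * n)%N.-primitive_root u -> (0 < k < n)%N ->
  u ^+ k != 0 /\ u ^+ k != (u ^+ k)^-1.
Proof.
move=> uP /andP[k0 kn].
have u0 : u ^+ k != 0.
  by rewrite expf_neq0 // (prim_root_eq0 uP) muln_eq0 negb_or; case: (n) kn.
split=> //; apply/eqP => uu; have := prim_order_dvd uP (k + k).
rewrite exprD {2}uu divff // eqxx => /dvdn_leq; rewrite addn_gt0 k0 => /(_ isT).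
by lia.
Qed.

Lemma conj_class_inv (lam : F) : conj_class lam^-1 = conj_class lam.
Proof. by rewrite /conj_class invrK addrC. Qed.

(** The eigenvalues of A are inverse to each other and are 2n-th roots of unity
    other than 1 and -1, so one of them is u^k with 0 < k < n. *)
Lemma scalar_power_class n (u : F) A c : (0 < n)%N -> (2 * n)%N.-primitive_root u ->
  \det A = 1 -> (forall x, A <> x%:M) -> A ^+ n = c%:M -> c ^+ 2 = 1 ->
  exists k, [/\ (0 < k < n)%N, c = (-1) ^+ k & conj_class (u ^+ k) A].
Proof.
move=> n0 uP dA Ans An c2; have u0 : u != 0.
  by rewrite (prim_root_eq0 uP) muln_eq0 negb_or /= -lt0n.
have [lam [lam0 lamV tA ln]] := SL2_scalar_power n0 dA Ans An.
have l2n : lam ^+ (2 * n) = 1 by rewrite mulnC exprM ln.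
have [[k k2n] /= lk] := prim_rootP uP l2n.
have u2 : u ^+ n * u ^+ n = 1 by rewrite (prim_root_half n0 uP) mulN1r opprK.
have kpos : (0 < k)%N.
  by rewrite lt0n; apply: contra lamV => /eqP k0; rewrite lk k0 expr0 invr1.
have [kn|nk] := ltnP k n.
  exists k; rewrite kpos kn -lk; split=> //.
  by rewrite -ln lk exprAC (prim_root_half n0 uP).
have kn : (n < k)%N.
  rewrite ltn_neqAle nk andbT; apply: contra lamV => /eqP nk'.
  by rewrite lk -nk' -[X in _ == X]mul1r -u2 mulfK // expf_neq0.
have lVk : u ^+ (2 * n - k) = lam^-1.
  apply: (mulfI lam0); rewrite divff // lk -exprD subnKC ?prim_expr_order //.
  exact: ltnW.
exists (2 * n - k)%N; split; first by apply/andP; split; lia.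
  have: ((-1) ^+ k : F) = (-1) ^+ (2 * n - k).
    by rewrite -[LHS]signr_odd -[RHS]signr_odd oddB ?oddM //; exact: ltnW.
  by move=> <-; rewrite -ln lk exprAC (prim_root_half n0 uP).
by rewrite lVk conj_class_inv.
Qed.

Lemma class_scalar_power n (u : F) A k : (2 * n)%N.-primitive_root u -> (0 < k < n)%N ->
  conj_class (u ^+ k) A -> A ^+ n = ((-1) ^+ k)%:M.
Proof.
move=> uP kn [dA tA]; have [l0 lV] := prim_root_neqV uP kn.
have n0 : (0 < n)%N by lia.
have lmu : u ^+ k - (u ^+ k)^-1 != 0 by rewrite subr_eq0.
have := SL2_expr_distinct n (divff l0) dA tA.
have E : (u ^+ k) ^+ n = (-1) ^+ k by rewrite exprAC (prim_root_half n0 uP).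
rewrite exprVn E invr_sign subrr scale0r sub0r -raddfN -mulrBr -mulrN opprB.
rewrite /= mulrC -scale_scalar_mx; exact: scalerI.
Qed.

(** The trace x + 1/x determines x up to inversion, and no two exponents strictly
    between 0 and n give inverse powers of u. *)
Lemma class_trace_inj n (u : F) A k k' : (2 * n)%N.-primitive_root u ->
  (0 < k < n)%N -> (0 < k' < n)%N ->
  conj_class (u ^+ k) A -> conj_class (u ^+ k') A -> k = k'.
Proof.
move=> uP kn kn' [_ T1] [_ T2]; have T := etrans (esym T1) T2.
have [l0 _] := prim_root_neqV uP kn; have [l0' _] := prim_root_neqV uP kn'.
have /eqP : (u ^+ k - u ^+ k') * (u ^+ k * u ^+ k' - 1) = 0.
  rewrite (_ : _ * _ = u ^+ k * u ^+ k' * (u ^+ k + (u ^+ k)^-1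
    - (u ^+ k' + (u ^+ k')^-1))); first by rewrite T subrr mulr0.
  by field; rewrite l0 l0'.
rewrite mulf_eq0 !subr_eq0 => /orP[|].
  by rewrite (eq_prim_root_expr uP) !modn_small => [/eqP| |] //; lia.
rewrite -exprD -(prim_order_dvd uP) => /dvdn_leq; lia.
Qed.

Section Cover.
Variables (p t : nat) (w z : F).
Hypotheses (p_gt1 : (1 < p)%N) (t_gt1 : (1 < t)%N).
Hypotheses (wP : (2 * p)%N.-primitive_root w) (zP : (2 * t)%N.-primitive_root z).

Lemma class_pair_sub_pair_variety k l : (0 < k < p)%N -> (0 < l < t)%N -> odd k = odd l ->
  class_pair (w ^+ k) (z ^+ l) `<=` pair_variety p t.
Proof.
move=> kp lt kl v [cA cB]; split; [by case: cA|by case: cB|].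
rewrite (class_scalar_power wP kp cA) (class_scalar_power zP lt cB).
by rewrite -signr_odd kl signr_odd.
Qed.

(** If A and B do not commute, the common power A^p = B^t commutes with both and
    is therefore scalar, with square 1. *)
Lemma pair_variety_cover v : pair_variety p t v -> ~ commuting_pairs p t v ->
  exists k l, [/\ (0 < k < p)%N, (0 < l < t)%N, odd k = odd l
    & class_pair (w ^+ k) (z ^+ l) v].
Proof.
move=> Vv nc; case: (Vv) => dA dB AB.
have {}nc : point_mx 0 v *m point_mx 1 v <> point_mx 1 v *m point_mx 0 v by move=> c; apply: nc.
rewrite /class_pair /=; move: (point_mx 0 v) (point_mx 1 v) dA dB AB nc => A B dA dB AB nc.
have [c Ac] : exists c, A ^+ p = c%:M.
  apply: contrapT => /forallNP Ans; apply: nc; apply: (commute_commutant Ans).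
    by rewrite mulmxE -exprS exprSr.
  by rewrite AB mulmxE -exprS exprSr.
have c2 : c ^+ 2 = 1.
  by have := det_expr A p; rewrite Ac det_scalar dA expr1n.
have Ans x : A <> x%:M by move=> Ax; apply: nc; rewrite Ax mul_scalar_mx mul_mx_scalar.
have Bns x : B <> x%:M by move=> Bx; apply: nc; rewrite Bx mul_scalar_mx mul_mx_scalar.
have [k [kp ck Ak]] := scalar_power_class (ltnW p_gt1) wP dA Ans Ac c2.
rewrite AB in Ac.
have [l [lt cl Bl]] := scalar_power_class (ltnW t_gt1) zP dB Bns Ac c2.
exists k, l; split=> //; move/eqP: cl; rewrite ck -signr_odd -[X in _ == X]signr_odd.
by rewrite (inj_eq (@signr_inj F)) => /eqP.
Qed.

End Cover.

End PairVariety.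

(** * Representations of < a, b ; a^p = b^t > in SL2 *)

Section RepresentationVariety.
Local Open Scope ring_scope.
Variables (R : realType) (p t : nat).
Local Notation F := (complex R).

Lemma representation_point_pair (rho : Gpt p t -> 'M[F]_2) :
  representation_point (Gpt_gen p t) rho =
  pair_point (rho (Gpt_gen p t 0)) (rho (Gpt_gen p t 1)).
Proof.
congr mxvec; apply/row_matrixP => i; rewrite !rowK; congr mxvec.
by elim/ord2_ind: i.
Qed.

(** By the presentation, any pair of matrices in SL2 with A^p = B^t extends to a
    representation; inverse letters act by adjugates. *)
Lemma representation_varietyE :
  representation_variety R (Gpt_gen p t) = @pair_variety F p t.
Proof.
apply/seteqP; split.
  move=> _ [rho [[rho1 rhoM rhod] ->]]; rewrite representation_point_pair.
  have rhoX x k : rho (x ^+ k)%g = rho x ^+ k.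
    elim: k => [|k IH]; first by rewrite expg0 rho1.
    by rewrite expgS exprS rhoM IH mulmxE.
  rewrite /pair_variety /= point_mx_pair0 point_mx_pair1; split=> //.
  by rewrite -!rhoX Gpt_relation.
move=> v [dA dB AB].
have dM i : \det (point_mx i v) = 1 by elim/ord2_ind: i.
pose h (l : 'I_2 * bool) := if l.2 then \adj (point_mx l.1 v) else point_mx l.1 v.
have hV l : h l *m h (inv_letter l) = 1%:M.
  by case: l => i []; rewrite /h /= ?mul_adj_mx ?mul_mx_adj dM.
have eval_nseq i k :
    word_eval (@mulmx F 2 2 2) 1%:M h (nseq k (i, false)) = point_mx i v ^+ k.
  by elim: k => [//|k IH]; rewrite /= IH exprS mulmxE.
have hrels l r : Gpt_rels p t (l, r) ->
    word_eval (@mulmx F 2 2 2) 1%:M h l = word_eval (@mulmx F 2 2 2) 1%:M h r.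
  by move=> E; rewrite (congr1 fst E : l = _) (congr1 snd E : r = _) !eval_nseq.
have mA : associative (@mulmx F 2 2 2) by move=> A B C; exact: mulmxA.
have m1 : left_id 1%:M (@mulmx F 2 2 2) by move=> A; exact: mul1mx.
have m1' : right_id 1%:M (@mulmx F 2 2 2) by move=> A; exact: mulmx1.
exists (@presented_eval 2 (Gpt_rels p t) _ (@mulmx F 2 2 2) 1%:M h); split.
  split; first exact: presented_eval1.
    by move=> x y; exact: presented_evalM.
  elim/presented_gen_ind => [|i x IH|i x IH].
  - by rewrite presented_eval1 // det1.
  - by rewrite presented_evalM // det_mulmx IH presented_eval_gen // dM mulr1.
  - rewrite presented_evalM // det_mulmx IH presented_eval_genV // mulr1 /=.
    have := congr1 determinant (hV (i, true)).
    by rewrite det_mulmx det1 /h /= dM mulr1.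
by rewrite representation_point_pair !presented_eval_gen // pair_point_mx.
Qed.

End RepresentationVariety.

(** * Counting the components *)

Definition parity_pairs (p t : nat) : seq (nat * nat) :=
  [seq kl <- [seq (k, l) | k <- iota 1 p.-1, l <- iota 1 t.-1] | odd kl.1 == odd kl.2].

Lemma parity_pairsP p t k l :
  reflect [/\ 0 < k < p, 0 < l < t & odd k = odd l]%N ((k, l) \in parity_pairs p t).
Proof.
rewrite mem_filter; apply: (iffP andP) => /= [[/eqP kl /allpairsP[[k' l'] /= []]]|[kp lt kl]].
  by rewrite !mem_iota => kp lt [E1 E2]; subst; split=> //; lia.
split; first exact/eqP.
by apply/allpairsP; exists (k, l); rewrite !mem_iota /=; split=> //; lia.
Qed.

Lemma count_odd_iota m n : count odd (iota m n) = (if odd m then uphalf n else n./2).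
Proof. by elim: n m => [|n IH] m /=; [case: odd|rewrite IH /=; case: odd]. Qed.

(** Among 1, ..., m the numbers of odd and of even terms are equal when m is even;
    one of p - 1 and t - 1 is even. *)
Lemma size_parity_pairs p t : coprime p t ->
  (2 * size (parity_pairs p t) = p.-1 * t.-1)%N.
Proof.
move=> pt; have : ~~ (odd p.-1 && odd t.-1).
  apply: contraL pt => /andP[op ot]; rewrite /coprime; apply/negP => /eqP g1.
  have even_succ n : odd n.-1 -> ~~ odd n by case: n => //= n ->.
  have : (2 %| gcdn p t)%N by rewrite dvdn_gcd !dvdn2 !even_succ.
  by rewrite g1.
rewrite size_filter; move: p.-1 t.-1 => m n mn {p t pt}.
have count_pairs (r s : seq nat) :
    count (fun kl => odd kl.1 == odd kl.2) [seq (k, l) | k <- r, l <- s]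
    = (count odd r * count odd s + (size r - count odd r) * (size s - count odd s))%N.
  elim: r => [//|k r IH]; rewrite /= count_cat IH count_map.
  have := count_size odd r; have := count_predC odd s.
  have -> : count (preim (pair k) (fun kl => odd kl.1 == odd kl.2)) s
      = count (if odd k then odd else predC odd) s.
    by apply: eq_count => l /=; case: (odd k) => //=; case: (odd l).
  by case: (odd k) => /=; nia.
rewrite count_pairs !count_odd_iota !size_iota /= !uphalf_half.
move: mn (odd_double_half m) (odd_double_half n).
move: (odd m) (odd n) (m./2) (n./2) => o o' a b oo Em En.
have -> : (m - (o + a) = a)%N by lia.
have -> : (n - (o' + b) = b)%N by lia.
by rewrite -Em -En -!muln2; case: o o' oo {Em En} => [] [] //= _; nia.
Qed.

Section ComponentCount.
Local Open Scope ring_scope.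
Variables (F : numClosedFieldType) (p t : nat).
Hypotheses (p_gt1 : (1 < p)%N) (t_gt1 : (1 < t)%N) (pt : coprime p t).

(** An irreducible subset of dimension 4 cannot lie among the commuting pairs, so
    it is contained in, and by maximality equal to, one of the products of two
    conjugacy classes. *)
Lemma four_dimensional_components (w z : F) :
  (2 * p)%N.-primitive_root w -> (2 * t)%N.-primitive_root z ->
  [set Z | irreducible_component (@pair_variety F p t) Z /\ krull_dim Z 4]
  = (fun kl => class_pair (w ^+ kl.1) (z ^+ kl.2)) @` [set` parity_pairs p t].
Proof.
move=> wP zP; have t0 := ltnW t_gt1.
have Ecl k l : (0 < k < p)%N -> (0 < l < t)%N ->
    [/\ zariski_closed (class_pair (w ^+ k) (z ^+ l)),
        zariski_irreducible (class_pair (w ^+ k) (z ^+ l))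
      & krull_dim (class_pair (w ^+ k) (z ^+ l)) 4].
  move=> /(prim_root_neqV wP)[l0 lV] /(prim_root_neqV zP)[n0 nV]; split.
  - exact: zariski_closed_class_pair.
  - exact: class_pair_irreducible.
  - exact: krull_dim_class_pair.
have dimD Z : Z `<=` @commuting_pairs F p t -> ~ irreducible_chain Z 4.
  move=> ZD [C [Cirr Clt]].
  have : irreducible_chain (@commuting_pairs F p t) 4.
    exists C; split=> // i /Cirr[? ? CZ]; split=> //.
    exact: subset_trans CZ ZD.
  by move=> /(dominates_chain_le (commuting_pairs_dominated F t0 pt)).
have cover Z : zariski_irreducible Z -> Z `<=` @pair_variety F p t ->
    Z `<=` @commuting_pairs F p t \/
    exists2 kl, kl \in parity_pairs p t & Z `<=` class_pair (w ^+ kl.1) (z ^+ kl.2).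
  move=> Zirr ZV; apply: irreducible_finite_union => //.
  - exact: zariski_closed_commuting_pairs.
  - by move=> [k l] /parity_pairsP[kp lt _]; have [] := Ecl k l kp lt.
  move=> v /ZV Vv; have [|nc] := pselect (@commuting_pairs F p t v); [by left|right].
  have [k [l [kp lt kl cv]]] := pair_variety_cover p_gt1 t_gt1 wP zP Vv nc.
  by exists (k, l) => //; exact/parity_pairsP.
have EV k l : (k, l) \in parity_pairs p t ->
    irreducible_closed_in (@pair_variety F p t) (class_pair (w ^+ k) (z ^+ l)).
  move=> /parity_pairsP[kp lt kl]; have [cE Eirr _] := Ecl k l kp lt.
  by split=> //; exact: class_pair_sub_pair_variety.
apply/seteqP; split => [Z [[[cZ Zirr ZV] Zmax] [Z4 _]]|_ [[k l] kls <-]].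
  have [/dimD//|[[k l] kls ZE]] := cover Z Zirr ZV.
  by exists (k, l) => //; apply: Zmax => //; exact: EV.
have /parity_pairsP[kp lt kl] := kls; have [cE Eirr E4] := Ecl k l kp lt.
split=> //; split; first exact: EV.
move=> Z [cZ Zirr ZV] EZ; apply/seteqP; split=> //.
have [ZD|[[k' l'] /parity_pairsP[kp' lt' _] ZE]] := cover Z Zirr ZV.
  by case: (dimD _ (subset_trans EZ ZD)); case: E4.
have [v Ev] := Eirr.1; have [cA cB] := Ev; have [cA' cB'] := ZE _ (EZ _ Ev).
by rewrite (class_trace_inj wP kp kp' cA cA') (class_trace_inj zP lt lt' cB cB').
Qed.

Lemma card_four_dimensional_components :
  ([set Z | irreducible_component (@pair_variety F p t) Z /\ krull_dim Z 4]
   #= `I_(size (parity_pairs p t)))%card.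
Proof.
have [w wP] : exists w : F, (2 * p)%N.-primitive_root w.
  by apply: prim_root_exists; lia.
have [z zP] : exists z : F, (2 * t)%N.-primitive_root z.
  by apply: prim_root_exists; lia.
pose E (kl : nat * nat) := class_pair (w ^+ kl.1) (z ^+ kl.2).
rewrite (four_dimensional_components wP zP) -/E.
set s := parity_pairs p t.
have us : uniq s by rewrite filter_uniq // allpairs_uniq ?iota_uniq // => -[? ?] [? ?].
rewrite (_ : E @` [set` s] = (fun i => E (nth (0, 0)%N s i)) @` `I_(size s)).
  apply: inj_card_eq => i j; rewrite !inE /= => si sj Eij.
  apply/eqP; rewrite -(nth_uniq (0, 0)%N si sj us); apply/eqP.
  move: (mem_nth (0, 0)%N si) (mem_nth (0, 0)%N sj) Eij.
  move: (nth _ s i) (nth _ s j) => [k l] [k' l'].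
  move=> /parity_pairsP[kp lt _] /parity_pairsP[kp' lt' _] Ekl.
  have [l0 lV] := prim_root_neqV wP kp; have [n0 nV] := prim_root_neqV zP lt.
  have [v Ev] := (class_pair_irreducible l0 lV n0 nV).1.
  have [cA cB] := Ev; have : E (k', l') v by rewrite -Ekl.
  move=> [cA' cB'].
  by rewrite (class_trace_inj wP kp kp' cA cA') (class_trace_inj zP lt lt' cB cB').
apply/seteqP; split => [_ [kl kls <-]|_ [i si <-]]; last first.
  by exists (nth (0, 0)%N s i) => //; exact: mem_nth.
by exists (index kl s); rewrite ?nth_index //= index_mem.
Qed.

End ComponentCount.

Theorem mainTheorem2 (R : realType) (p t : nat)
    (hp : (1 < p)%N) (ht : (1 < t)%N) (hpt : coprime p t)
    (K : set (sphere3 R)) (hK : torus_knot K) (x : knot_complement K)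
    (hG : group_isomorphic (knot_group x) (Gpt p t)) :
  exists g : nat,
    torus_knot_genus x g /\
    ([set Z | irreducible_component (representation_variety R (Gpt_gen p t)) Z
             /\ krull_dim Z 4] #= `I_g)%card.
Proof.
exists (size (parity_pairs p t)); split.
  rewrite /torus_knot_genus size_parity_pairs //.
  apply: (group_rank_commutator_iso hG); apply: Gpt_commutator_rank; exact: ltnW.
by rewrite representation_varietyE; exact: card_four_dimensional_components.
Qed.
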